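(* Suppose that $\delta\ge0$ and that $f:\mathbb{R}^n\to\mathbb{R}$ is $C^{1,1}$. Then $$\partial_{\delta}^2f(\boldsymbol{x})(\boldsymbol{w})=\partial_{\delta}\langle\boldsymbol{w},\nabla f\rangle(\boldsymbol{x})\quad\text{for all }\boldsymbol{x},\boldsymbol{w}\in\mathbb{R}^n.$$
   Context: A function $f:\mathbb{R}^n\to\mathbb{R}$ is $C^{1,1}$ if it is differentiable with Lipschitz continuous gradient. $\langle\boldsymbol{w},\nabla f\rangle$ denotes the function $\boldsymbol{x}\mapsto\langle\boldsymbol{w},\nabla f(\boldsymbol{x})\rangle$. $\mathbb{B}^n$ is the closed Euclidean unit ball of $\mathbb{R}^n$ and $\operatorname{conv}$ is the convex hull. For a Lipschitz function $g:\mathbb{R}^n\to\mathbb{R}$, the Clarke subdifferential $\partial_{\mathrm{C}}g(\boldsymbol{x})$ is the convex hull of the set of all limits $\lim_j\nabla g(\boldsymbol{y}_j)$ along sequences $\boldsymbol{y}_j\to\boldsymbol{x}$ of points at which $g$ is differentiable; the Goldstein $\delta$-subdifferential is $\partial_{\delta}g(\boldsymbol{x}):=\operatorname{conv}\big(\bigcup_{\boldsymbol{y}\in\boldsymbol{x}+\delta\mathbb{B}^n}\partial_{\mathrm{C}}g(\boldsymbol{y})\big)$. For a $C^{1,1}$-function $f$, the Clarke generalized Hessian $\partial_{\mathrm{C}}^2f(\boldsymbol{x})\subseteq\mathbb{R}^{n\times n}_{\mathrm{sym}}$ is the convex hull of the set of all limits $\lim_j\nabla^2f(\boldsymbol{y}_j)$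 along sequences $\boldsymbol{y}_j\to\boldsymbol{x}$ of points at which $f$ is twice differentiable, and $\partial_{\mathrm{C}}^2f(\boldsymbol{x})(\boldsymbol{w}):=\{\boldsymbol{A}\boldsymbol{w}:\boldsymbol{A}\in\partial_{\mathrm{C}}^2f(\boldsymbol{x})\}$. The Goldstein second-order $\delta$-subdifferential is the set-valued mapping $\partial_{\delta}^2f(\boldsymbol{x})(\boldsymbol{w}):=\operatorname{conv}\big(\bigcup_{\boldsymbol{y}\in\boldsymbol{x}+\delta\mathbb{B}^n}\partial_{\mathrm{C}}^2f(\boldsymbol{y})(\boldsymbol{w})\big)$, $\boldsymbol{w}\in\mathbb{R}^n$. *)

(* Defs.v *)
From HB Require Import structures.
From mathcomp Require Import all_boot all_order all_algebra.
From mathcomp Require Import all_classical all_reals all_analysis.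

Set Implicit Arguments.
Unset Strict Implicit.
Unset Printing Implicit Defensive.

Import Order.TTheory GRing.Theory Num.Theory.
Import numFieldNormedType.Exports.

Local Open Scope classical_set_scope.
Local Open Scope ring_scope.

(* R^n is ['cV[R]_n]. Its topology, differentiability and Lipschitz continuity
   are the library's, which come from the sup norm: norms on R^n are equivalent,
   so these notions do not depend on the norm. Closed balls do depend on it,
   and are defined from the Euclidean norm. *)

Definition dot (R : realType) (n : nat) (u v : 'cV[R]_n) : R :=
  \sum_(i < n) u i ord0 * v i ord0.

Definition unit_ball (R : realType) (n : nat) : set 'cV[R]_n :=
  [set u | Num.sqrt (dot u u) <= 1].

Definition conv_hull (R : realType) (V : lmodType R) (A : set V) : set V :=
  smallest (@convex_set R V) A.

(* [gradient g x] and [hessian f x] are meaningful only where [g] is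
   differentiable, resp. [f] is twice differentiable, at [x]. *)
Definition gradient (R : realType) (n : nat) (g : 'cV[R]_n -> R)
    (x : 'cV[R]_n) : 'cV[R]_n :=
  \col_(i < n) ('d g x (delta_mx i ord0) : R).

Definition hessian (R : realType) (n : nat) (f : 'cV[R]_n -> R)
    (x : 'cV[R]_n) : 'M[R]_n :=
  \matrix_(i < n, j < n) ('d (gradient f) x (delta_mx j ord0) : 'cV[R]_n) i ord0.

Definition twice_differentiable (R : realType) (n : nat) (f : 'cV[R]_n -> R)
    (x : 'cV[R]_n) : Prop :=
  (\forall z \near x, differentiable f z) /\ differentiable (gradient f) x.

Definition C11 (R : realType) (n : nat) (f : 'cV[R]_n -> R) : Prop :=
  (forall x : 'cV[R]_n, differentiable f x) /\ lipschitz (gradient f).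

Definition clarke_subdiff (R : realType) (n : nat) (g : 'cV[R]_n -> R)
    (x : 'cV[R]_n) : set 'cV[R]_n :=
  conv_hull [set v : 'cV[R]_n | exists y : nat -> 'cV[R]_n,
    [/\ forall j, differentiable g (y j),
        y j @[j --> \oo] --> x
      & gradient g (y j) @[j --> \oo] --> v]].

Definition goldstein_subdiff (R : realType) (n : nat) (delta : R)
    (g : 'cV[R]_n -> R) (x : 'cV[R]_n) : set 'cV[R]_n :=
  conv_hull (\bigcup_(y in [set x + delta *: b | b in @unit_ball R n])
    clarke_subdiff g y).

Definition clarke_hessian (R : realType) (n : nat) (f : 'cV[R]_n -> R)
    (x : 'cV[R]_n) : set 'M[R]_n :=
  conv_hull [set A : 'M[R]_n | exists y : nat -> 'cV[R]_n,
    [/\ forall j, twice_differentiable f (y j),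
        y j @[j --> \oo] --> x
      & hessian f (y j) @[j --> \oo] --> A]].

Definition clarke_hessian_app (R : realType) (n : nat) (f : 'cV[R]_n -> R)
    (x w : 'cV[R]_n) : set 'cV[R]_n :=
  [set A *m w | A in clarke_hessian f x].

Definition goldstein_hessian (R : realType) (n : nat) (delta : R)
    (f : 'cV[R]_n -> R) (x w : 'cV[R]_n) : set 'cV[R]_n :=
  conv_hull (\bigcup_(y in [set x + delta *: b | b in @unit_ball R n])
    clarke_hessian_app f y w).

(* Main.v *)
From HB Require Import structures.
Require Import Defs.
From mathcomp Require Import all_boot all_order all_algebra.
From mathcomp Require Import all_classical all_reals all_analysis.
From mathcomp Require Import measurable_realfun.
From mathcomp Require Import ring lra.

Set Implicit Arguments.
Unset Strict Implicit.
Unset Printing Implicit Defensive.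

Import Order.TTheory GRing.Theory Num.Theory.
Import numFieldNormedType.Exports.

Local Open Scope classical_set_scope.
Local Open Scope ring_scope.

(** The heart of the matter is the pointwise identity
    [clarke_hessian_app f x w = clarke_subdiff <w, grad f> x]; the statement for
    [delta] follows by taking unions over the ball and convex hulls.

    One inclusion is the chain rule. Where the gradient is differentiable, the
    second derivative is symmetric ([hessian_sym], through the second
    difference quotient), hence [grad <w, grad f> (z) = hessian f z *m w]
    ([gradient_dot]), and limits of Hessians applied to [w] are limits of
    gradients.

    The other inclusion is harder, since [<w, grad f>] may well be
    differentiable at points where [grad f] is not. Let [v] be a limit of
    gradients of [<w, grad f>]. The limits [A] of Hessians at [x] form a compact
    set, so the vectors [A *m w] do too, and by Caratheodory's theorem their
    convex hull is compact; therefore it suffices to find, for every direction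
    [u], one such [A] with [<u, v> <= <u, A w>] ([mem_conv_hull_of_support]).
    The gradients approaching [v] provide short segments in the direction [u]
    along which [<w, grad f>] grows at a rate close to [<u, v>]. A mean value
    inequality ([mean_value_diff]) turns this into points [z] near [x] where
    [grad f] is differentiable and where [<w, hessian f z u>] is at least about
    [<u, v>]; a cluster point of these Hessians is the wanted [A].

    The mean value inequality says that a Lipschitz map has enough points of
    differentiability: this is Rademacher's theorem together with Fubini's. Both
    are obtained here without Lebesgue measure on R^n. For a Borel set [A] let
    [posline b A] be the set of the points whose parallel to [b] meets [A] in a
    set of positive length. By Fubini's theorem on the plane these operators
    commute ([posline_comm]), so the sets that vanish after applying them along
    all the basis vectors form a sigma-ideal ([linenull]) which contains every
    Borel set of null slices in one basis direction, and no nonempty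
    open set is contained in [posline u A] for [A] in the ideal, whatever the direction [u]
    ([linenull_open_posline]).

    Rademacher's theorem is then proved by induction on the number of
    coordinates ([approx_linearS]). In dimension one, a Lipschitz function is
    the integral of a density, by the Radon-Nikodym theorem applied to its
    Stieltjes measure, so that Lebesgue's differentiation theorem applies. In
    the inductive step, let [E] be the closed set of the points where the
    difference quotients in the new direction are uniformly close to a given
    number. The distance to [E] is again a Lipschitz function; where it is
    differentiable in the former directions and vanishes, it is minimal, so
    points of [E] are found at distance [o(h)] of [x + h], and from there one
    may move in the new direction. *)

(** * Lipschitz functions on the line *)

Definition lipschitz_with (R : realType) (V W : normedModType R) (L : R) (f : V -> W) :=
  forall x y, `|f x - f y| <= L * `|x - y|.

Lemma lip_continuous (R : realType) (V W : normedModType R) (L : R)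
  (f : V -> W) : lipschitz_with L f -> continuous f.
Proof.
move=> Lf x; apply/cvgrPdist_le => e e0.
have K0 : 0 < `|L| + 1 by rewrite ltr_wpDl.
near=> y.
apply: (le_trans (Lf x y)).
apply: (@le_trans _ _ ((`|L| + 1) * `|x - y|)).
  by rewrite ler_wpM2r// (le_trans (ler_norm L))// lerDl.
rewrite -ler_pdivlMl//; near: y.
by apply: (@cvgr_dist_le _ _ _ (nbhs x) _ id x) => //; rewrite mulr_gt0// invr_gt0.
Unshelve. all: by end_near. Qed.

Section density.
Context {R : realType}.
Notation mu := (@lebesgue_measure R).

Definition cumulative_of (h : R -> R) (nd : nondecreasing h) (ch : continuous h)
  : cumulative R R.
Proof.
refine (@Cumulative.Pack _ _ _ h (Cumulative.Class
  (isCumulative.Build R _ R h nd _))).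
by move=> x; apply: cvg_at_right_filter; exact: ch.
Defined.

Lemma stieltjes_measure_oc (h : cumulative R R) (a b : R) : a <= b ->
  lebesgue_stieltjes_measure h `]a, b]%classic = (h b - h a)%:E.
Proof.
move=> ab; rewrite /lebesgue_stieltjes_measure /measure_extension.
rewrite measurable_mu_extE/=; last exact: is_ocitv.
by rewrite wlength_itv_bnd.
Qed.

(** The two measures differ by the Stieltjes measure of the difference of the
    functions; half-open intervals determine it. *)
Lemma stieltjes_measure_le (h k : cumulative R R) : nondecreasing (fun x => k x - h x) ->
  continuous h -> continuous k ->
  forall A, measurable A ->
  (lebesgue_stieltjes_measure h A <= lebesgue_stieltjes_measure k A)%E.
Proof.
move=> nd ch ck A mA.
have cd : continuous (fun x => k x - h x) by move=> x; apply: cvgB; [exact: ck|exact: ch].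
pose d := cumulative_of nd cd.
rewrite (@lebesgue_stieltjes_measure_unique _ k
  (measure_add (lebesgue_stieltjes_measure h) (lebesgue_stieltjes_measure d)))//.
  by rewrite [leRHS](measure_addE (lebesgue_stieltjes_measure h)) leeDl// measure_ge0.
move=> X [[x y] _ <-] /=; rewrite [RHS](measure_addE (lebesgue_stieltjes_measure h)).
have [xy|xy] := leP x y; last first.
  by rewrite set_itv_ge ?measure0 ?adde0// bnd_simp -leNgt ltW.
have := stieltjes_measure_oc d xy; have := stieltjes_measure_oc h xy.
have := stieltjes_measure_oc k xy; rewrite /= => -> -> ->.
rewrite -EFinD; congr EFin; ring.
Qed.

(** The Stieltjes measure of a [K]-Lipschitz function is at most [|K| + 1] times
    Lebesgue measure, hence has a Radon-Nikodym density. *)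
Lemma lipschitz_density (h : R -> R) (K a b : R) :
  nondecreasing h -> lipschitz_with K h -> a < b ->
  exists g : R -> R, [/\ forall x, 0 <= g x,
     mu.-integrable setT (EFin \o g) &
     forall x, x \in `[a, b] -> (h x - h a)%:E = (\int[mu]_(t in `]a, x]) (g t)%:E)%E].
Proof.
move=> nd Lh ab.
have ch := lip_continuous Lh.
pose H := cumulative_of nd ch.
pose L := `|K| + 1; have L0 : 0 < L by rewrite /L ltr_wpDl.
have ndL : nondecreasing (fun x : R => L * x) by move=> x y xy; rewrite ler_pM2l.
have cL : continuous (fun x : R => L * x) by move=> x; apply: cvgZr; exact: cvg_id.
pose kL := cumulative_of ndL cL.
have L'0 : 0 <= L by rewrite ltW.
have leH A : measurable A -> (lebesgue_stieltjes_measure H A <= L%:E * mu A)%E.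
  move=> mA; rewrite [leRHS](_ : _ = lebesgue_stieltjes_measure kL A).
    apply: stieltjes_measure_le => //= x y xy.
    have := Lh y x; rewrite !ger0_norm ?subr_ge0 ?nd// => /le_trans -/(_ (L * (y - x))).
    have /[swap] /[apply] : K * (y - x) <= L * (y - x).
      by rewrite ler_wpM2r ?subr_ge0// /L (le_trans (ler_norm K))// lerDl.
    lra.
  rewrite (@lebesgue_stieltjes_measure_unique _ kL (mscale (NngNum L'0) mu))//.
  move=> X [[x y] _ <-] /=; rewrite /mscale/=.
  have [xy|xy] := leP x y; last first.
    by rewrite set_itv_ge ?measure0 ?mule0// bnd_simp -leNgt ltW.
  rewrite (stieltjes_measure_oc kL xy)/= lebesgue_measure_itv/= lte_fin.
  case: ltgtP xy => // [xy _|-> _]; first by rewrite -EFinB -EFinM mulrBr.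
  by rewrite subrr mule0.
(* the density theorem needs a finite measure: restrict to the interval *)
pose D : set (measurableTypeR R) := `]a, b]%classic.
have mD : measurable D by exact: measurable_itv.
have Dfin : (lebesgue_stieltjes_measure H D < +oo)%E.
  by rewrite stieltjes_measure_oc ?ltW// ltry.
pose nu := mfrestr mD Dfin.
have num : nu `<< mu.
  apply/null_content_dominatesP => A mA A0.
  apply/eqP; rewrite eq_le measure_ge0 andbT /nu /mfrestr /mrestr/=.
  apply: (@le_trans _ _ (L%:E * mu (A `&` D))%E).
    by apply: leH; exact: measurableI.
  rewrite (_ : mu (A `&` D) = 0%E) ?mule0//.
  by apply: subset_measure0 A0 => //; exact: measurableI.
have [f [f0 ffin fint fE]] := @radon_nikodym_sigma_finite _ (measurableTypeR R) R mu nu num.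
exists (fine \o f); split => //.
- by move=> x; rewrite /= fine_ge0.
- rewrite (_ : _ \o _ = f)//; apply/funext => x /=.
  by rewrite fineK.
- move=> x; rewrite in_itv/= => /andP[ax xb].
  under eq_integral do rewrite /= fineK//.
  rewrite -fE; last exact: measurable_itv.
  rewrite /= /nu /mfrestr /mrestr setIidl; first by rewrite (stieltjes_measure_oc H ax).
  by move=> t/=; rewrite /D/= !in_itv/= => /andP[-> /le_trans ->].
Qed.

Lemma derive1_near_addr (F h : R -> R) (c x : R) :
  (\near x, F x + c = h x) -> derivable F x 1 ->
  derivable h x 1 /\ h^`()%classic x = F^`()%classic x.
Proof.
move=> Fh dF.
have D1 := @is_derive_cst R R R c x 1.
have D2 := @is_deriveD R R R F (cst c) x 1 _ _ (derivableP dF) D1.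
have [dh hE] := near_eq_is_derive Fh D2.
by split=> //; rewrite !derive1E hE addr0.
Qed.

(** Almost every point is a Lebesgue point of the density, where the primitive has
    the density as derivative. *)
Lemma ae_derivable_density (h g : R -> R) (a b : R) :
  mu.-integrable setT (EFin \o g) ->
  (forall x : R, x \in `[a, b] -> (h x - h a)%:E = (\int[mu]_(t in `]a, x]) (g t)%:E)%E) ->
  {ae mu, forall x : R, x \in `]a, b[ -> derivable h x 1 /\ h^`()%classic x = g x}.
Proof.
move=> ig hE.
have := lebesgue_differentiation (open_integrable_locally openT ig).
apply: (@filterS _ _ (ae_filter_ringOfSetsType mu)) => x lx; rewrite in_itv/= => /andP[ax xb].
have := @FTC1_lebesgue_pt R g (BRight a) x b xb.
have igab : mu.-integrable `]a, b] (EFin \o g).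
  apply: (@integrableS _ (measurableTypeR R) _ mu setT) => //.
move=> /(_ igab) H; have {H} := H ax lx.
set F := fun y : R => _.
have hF : \near x, F x + h a = h x.
  near=> y; have : y \in `[a, b].
    apply: subset_itv_oo_cc; near: y.
    by apply: near_in_itvoo; rewrite in_itv/= ax xb.
  by move=> /hE yE; rewrite /F /Rintegral -yE/=; ring.
move=> [dF F'].
by have [? ->] := derive1_near_addr hF dF.
Unshelve. all: by end_near. Qed.

End density.

Section lipschitz_1d.
Context {R : realType}.
Notation mu := (@lebesgue_measure R).

(** Adding a steep linear function reduces Lipschitz functions to nondecreasing
    ones, which have a Stieltjes measure. *)
Lemma lip_add_linear (h : R -> R) (K L : R) : lipschitz_with K h -> `|K| <= L ->
  nondecreasing (fun x => h x + L * x) /\ lipschitz_with (K + L) (fun x => h x + L * x).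
Proof.
move=> Lh KL; have L0 : 0 <= L := le_trans (normr_ge0 _) KL.
have KL' : K <= L := le_trans (ler_norm _) KL.
split=> [x y xy|x y].
  have := Lh x y; rewrite distrC [`|x - y|]distrC [`|y - x|]ger0_norm ?subr_ge0//.
  rewrite ler_norml => /andP[+ _] => hxy.
  have : K * (y - x) <= L * (y - x) by rewrite ler_wpM2r ?subr_ge0.
  lra.
rewrite (_ : _ - _ = (h x - h y) + L * (x - y)); last by ring.
rewrite (le_trans (ler_normD _ _))// mulrDl lerD//.
by rewrite normrM ger0_norm.
Qed.

Lemma is_derive_mull (L x : R) : is_derive x 1 (fun y : R => L * y) L.
Proof.
have := @is_deriveZ R R R id L x 1 1 (is_derive_id x 1).
by rewrite /GRing.scale/= mulr1.
Qed.

Lemma is_derive_subl (h : R -> R) (L x : R) :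
  derivable (fun y => h y + L * y) x 1 ->
  is_derive x 1 h ((fun y => h y + L * y)^`()%classic x - L).
Proof.
set H := fun y => _ => dH; rewrite derive1E.
have D := @is_deriveB R R R H (fun y => L * y) x 1 _ _ (derivableP dH) (is_derive_mull L x).
by rewrite (_ : h = H - (fun y => L * y))//; apply/funext => y; rewrite /H fctE addrK.
Qed.

Lemma lip_ae_derivable (h : R -> R) (K : R) : lipschitz_with K h ->
  {ae mu, forall x, derivable h x 1}.
Proof.
move=> Lh; have [nd LH] := lip_add_linear Lh (lexx _).
set H := fun x => _ in nd LH.
suff : {ae mu, forall x (n : nat), x \in `](- n.+1%:R : R), n.+1%:R[ -> derivable h x 1}.
  apply: (@filterS _ _ (ae_filter_ringOfSetsType mu)) => x /(_ (Num.bound `|x|)); apply.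
  rewrite in_itv/= -ltr_norml (lt_trans (archi_boundP (normr_ge0 x)))//.
  by rewrite ltr_nat.
apply: ae_foralln => n.
have n0 : - n.+1%:R < n.+1%:R :> R by rewrite gtrN.
have [g [g0 ig HE]] := lipschitz_density nd LH n0.
have := ae_derivable_density ig HE.
apply: (@filterS _ _ (ae_filter_ringOfSetsType mu)) => x /[apply] -[dH _].
by have [] := is_derive_subl dH.
Qed.

(** The increment is the integral of the derivative, so an almost everywhere bound
    on the derivative bounds the increment. *)
Lemma lip_mean_value (h : R -> R) (K c a b : R) : a < b -> lipschitz_with K h ->
  {ae mu, forall x : R, x \in `]a, b[ -> derivable h x 1 -> h^`()%classic x <= c} ->
  h b - h a <= c * (b - a).
Proof.
move=> ab Lh hc.
(* the summand [|c|] makes the bound [c + L] on the density nonnegative *)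
pose L := `|K| + `|c|.
have [nd LH] : nondecreasing (fun x => h x + L * x) /\ lipschitz_with (K + L) (fun x => h x + L * x).
  by apply: lip_add_linear => //; rewrite lerDl.
have [g [g0 ig HE]] := lipschitz_density nd LH ab.
have dH := ae_derivable_density ig HE.
have : ((h b + L * b - (h a + L * a))%:E <= ((c + L) * (b - a))%:E)%E.
  rewrite HE; last by rewrite in_itv/= lexx ltW.
  rewrite [leRHS](_ : _ = (\int[mu]_(t in `]a, b]) (c + L)%:E)%E); last first.
    rewrite integral_cst; last exact: measurable_itv.
    rewrite [X in (_ * X)%E]lebesgue_measure_itv/= lte_fin ab.
    by rewrite -EFinB -EFinM.
  apply: ae_ge0_le_integral.
  - exact: measurable_itv.
  - by move=> x _; rewrite lee_fin.
  - apply: (@measurable_funS _ _ (measurableTypeR R) _ setT) => //; exact: measurable_int ig.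
  - move=> x _; rewrite lee_fin /L addrC -addrA addr_ge0//.
    by rewrite -lerBlDr sub0r -normrN ler_norm.
  - exact: measurable_cst.
  have neb : {ae mu, forall x : R, x != b}.
    exists [set b]; split => //; last by move=> x /= /negP/negPn/eqP.
    exact: lebesgue_measure_set1.
  have FA := ae_filter_ringOfSetsType mu.
  near=> x; rewrite /= in_itv/= => /andP[ax xb]; rewrite lee_fin.
  have xab : x \in `]a, b[.
    rewrite in_itv/= ax lt_neqAle xb andbT /=.
    near: x; exact: neb.
  have [dx gx] : derivable (fun x => h x + L * x) x 1 /\ (fun x => h x + L * x)^`()%classic x = g x.
    by move: xab; near: x.
  have [dh hE] := is_derive_subl dx; rewrite -gx -lerBlDr -hE -derive1E.
  by move: xab dh; near: x.
by rewrite lee_fin; lra.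
Unshelve. all: by end_near. Qed.

End lipschitz_1d.

(** * Sets with null slices *)

Section positive_lines.
Context {R : realType} {V : normedModType R}.
Notation mu := (@lebesgue_measure R).
Notation RT := (measurableTypeR R).
Notation BT := (g_sigma_algebraType (@open V)).

Definition borel (A : set V) := measurable (A : set BT).

Lemma open_borel (A : set V) : open A -> borel A.
Proof. by move=> oA; apply: sub_sigma_algebra. Qed.

Lemma closed_borel (A : set V) : closed A -> borel A.
Proof.
move=> cA; rewrite -(setCK A); apply: measurableC.
by apply: open_borel; exact: closed_openC.
Qed.

Definition posline (b : V) (A : set V) : set V :=
  [set y : V | (0 < mu [set s : R | A (y + s *: b)%R])%E].

(** The preimage of an open set is a countable union of rectangles with rational
    data, the first factor being closed. *)
Lemma measurable_shift (b : V) :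
  measurable_fun setT (fun p : BT * RT => (p.1 : V) + (p.2 : R) *: b : BT).
Proof.
apply: (@measurability _ _ (BT * RT)%type BT setT _ (@open V)) => // _ [U oU <-]; rewrite setTI.
pose F (i : rat * nat) : set (BT * RT) :=
  [set y : BT | forall z : V, `|z| < i.2.+1%:R^-1 -> U ((y : V) + ratr i.1 *: b + z)]
  `*` [set s : RT | `|(s : R) - ratr i.1| * `|b| < i.2.+1%:R^-1].
rewrite (_ : _ @^-1` U = \bigcup_i F i).
  apply: countable_bigcupT_measurable => // -[r k]; apply: measurableX.
    apply: closed_borel; rewrite -openC openE => y /= /existsNP[z /not_implyP[zk nU]].
    apply/nbhs_ballP; exists (k.+1%:R^-1 - `|z|); first by rewrite /= subr_gt0.
    move=> y'; rewrite -ball_normE /= => yy' /(_ (z + (y - y'))) h; apply: nU.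
    have := h _; rewrite (_ : y' + ratr r *: b + (z + (y - y')) = y + ratr r *: b + z); last first.
      by rewrite addrCA [y' + _]addrC -addrA subrKC addrC [_ + y]addrC.
    apply; rewrite (le_lt_trans (ler_normD _ _))// -ltrBrDl//.
  have cf : continuous (fun s : R => `|s - ratr r| * `|b|).
    move=> s; apply: cvgMl; apply: cvg_norm; apply: cvgB; [exact: cvg_id|exact: cvg_cst].
  have /continuousP/(_ _ (@open_lt R k.+1%:R^-1)) := cf.
  exact: open_measurable.
apply/seteqP; split => [[y s]/= Uys|[y s] [[r k] _ [/= h sr]]]; last first.
  have := h ((s - ratr r) *: b); rewrite normrZ => /(_ sr).
  by rewrite -addrA -scalerDl subrKC.
move: oU; rewrite openE => /(_ _ Uys) /nbhs_ballP[e /= e0 eU].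
have [k ke] : exists k : nat, k.+1%:R^-1 < e / 2.
  have [k _ /(_ _ (leqnn k))] := near_infty_natSinv_lt (PosNum (divr_gt0 e0 (@ltr0n R 2))).
  by exists k.
have d0 : 0 < k.+1%:R^-1 / (`|b| + 1) :> R by rewrite divr_gt0// ltr_wpDl.
have [r] := @rat_in_itvoo R _ _ (ltr_pwDr d0 (lexx s)).
rewrite in_itv/= => /andP[sr rs].
have srk : `|s - ratr r| * `|b| < k.+1%:R^-1.
  have : `|s - ratr r| < k.+1%:R^-1 / (`|b| + 1).
    by rewrite distrC gtr0_norm ?subr_gt0// ltrBlDl.
  rewrite ltr_pdivlMr ?ltr_wpDl//; apply: le_lt_trans.
  by rewrite ler_wpM2l// lerDl.
exists (r, k) => //; split => //= z zk; apply: eU; rewrite -ball_normE /=.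
rewrite (_ : _ - _ = (s - ratr r) *: b - z); last first.
  by rewrite -(addrA y (ratr r *: b)) opprD addrACA subrr add0r opprD addrA scalerBl.
rewrite (le_lt_trans (ler_normB _ _))// normrZ (splitr e) ltrD//.
  exact: lt_trans srk _.
exact: lt_trans zk _.
Qed.

Lemma measurable_shift_preimage (b : V) (A : set V) : borel A ->
  measurable ([set p : BT * RT | A ((p.1 : V) + (p.2 : R) *: b)] : set (BT * RT)).
Proof. by move=> bA; rewrite -[X in measurable X]setTI; exact: (measurable_shift b). Qed.

Lemma xsection_shift (b y : V) (A : set V) :
  xsection ([set p : BT * RT | A ((p.1 : V) + (p.2 : R) *: b)] : set (BT * RT)) y =
  [set s : R | A (y + s *: b)].
Proof. by apply/seteqP; split => s; rewrite /xsection /= inE. Qed.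

Lemma measurable_line (b y : V) (A : set V) : borel A ->
  measurable ([set s : R | A (y + s *: b)] : set RT).
Proof.
move=> /(measurable_shift_preimage b)/(@measurable_xsection _ _ BT RT _ (y : BT)).
by rewrite xsection_shift.
Qed.

Lemma borel_posline (b : V) (A : set V) : borel A -> borel (posline b A).
Proof.
move=> /(measurable_shift_preimage b) mA.
have mx := @measurable_fun_xsection _ _ BT RT R mu _ mA.
have := @emeasurable_fun_o_infty _ BT R setT _ measurableT mx 0%E.
rewrite setTI /borel /posline /=; under eq_set do rewrite /= xsection_shift.
by [].
Qed.

Lemma posline_sub (b : V) (A B : set V) : borel A -> borel B -> A `<=` B ->
  posline b A `<=` posline b B.
Proof.
move=> bA bB AB y /= /lt_le_trans; apply.
by apply: le_measure; rewrite ?inE; [exact: measurable_line..|move=> s /AB].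
Qed.

Lemma posline_bigcup (b : V) (F : nat -> set V) : (forall k, borel (F k)) ->
  posline b (\bigcup_k F k) `<=` \bigcup_k posline b (F k).
Proof.
move=> bF y /= y0; apply: contrapT => nF; move: y0; apply/negP; rewrite -leNgt.
rewrite (_ : [set s | _] = \bigcup_k [set s : R | F k (y + s *: b)]); last first.
  by apply/seteqP; split => s [k _ Fk]; exists k.
rewrite (@measure_negligible _ RT R mu)//.
  by apply: bigcupT_measurable => k; exact: measurable_line.
apply: negligible_bigcup => k; exists [set s : R | F k (y + s *: b)].
split => //; first exact: measurable_line.
apply/eqP; rewrite eq_le measure_ge0 andbT leNgt.
by apply/negP => h; apply: nF; exists k.
Qed.

(** An open set contains a segment of every line through any of its points. *)
Lemma posline_open (b : V) (U A : set V) : open U -> borel A -> U `<=` A ->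
  U `<=` posline b A.
Proof.
move=> oU bA UA; apply: (@subset_trans _ (posline b U)); last first.
  by apply: posline_sub => //; exact: open_borel.
move=> y Uy /=.
have : \forall s \near (0 : R), U (y + s *: b).
  have cf : continuous (fun s : R => y + s *: b).
    by move=> s; apply: cvgD; [exact: cvg_cst|apply: cvgZl; exact: cvg_id].
  apply: (cf 0 U); rewrite scale0r addr0; exact: open_nbhs_nbhs.
move=> /nbhs_ballP[e /= e0 eU].
apply: (@lt_le_trans _ _ (mu (ball (0 : R) e))).
  by rewrite (lebesgue_measure_ball _ (ltW e0)) lte_fin mulrn_wgt0.
apply: le_measure; rewrite ?inE//; first exact: measurable_ball.
apply: measurable_line; exact: open_borel.
Qed.

(** Both conditions say that [X] is null for the product measure. *)
Lemma null_sections (X : set (RT * RT)) : measurable X ->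
  mu [set t : R | (0 < mu (ysection X t))%E] = 0%E ->
  mu [set s : R | (0 < mu (xsection X s))%E] = 0%E.
Proof.
move=> mX y0.
have my := @measurable_fun_ysection _ _ RT RT R mu _ mX.
have mx := @measurable_fun_xsection _ _ RT RT R mu _ mX.
have FE := @indic_fubini_tonelli_FE _ _ RT RT R mu _ mX.
have GE := @indic_fubini_tonelli_GE _ _ RT RT R mu _ mX.
have := @indic_fubini_tonelli _ _ RT RT R mu mu _ mX.
rewrite FE GE => FG.
have G0 : (\int[mu]_x `|(mu \o ysection X) x| = 0)%E.
  apply/ae_eq_integral_abs => //.
  exists [set t : R | (0 < mu (ysection X t))%E]; split => //.
    have := @emeasurable_fun_o_infty _ RT R setT _ measurableT my 0%E.
    by rewrite setTI.
  move=> t /= /not_implyP[_ /eqP n0].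
  by rewrite lt_neqAle eq_sym n0 measure_ge0.
have F0 : (\int[mu]_x `|(mu \o xsection X) x| = 0)%E.
  move: G0; under eq_integral do rewrite /= gee0_abs//.
  move=> G0; under eq_integral do rewrite /= gee0_abs//.
  by rewrite FG.
have /ae_eq_integral_abs[]// := F0.
move=> N [mN N0 sN]; apply: (subset_measure0 _ mN _ N0).
  have := @emeasurable_fun_o_infty _ RT R setT _ measurableT mx 0%E.
  by rewrite setTI.
by move=> s /= s0; apply: sN => /= /(_ I) h; rewrite h ltxx in s0.
Qed.

(** Both sides consist of the base points of the planes parallel to [b] and [c]
    that meet [A] in a set of positive area. *)
Lemma posline_comm (b c : V) (A : set V) : borel A ->
  posline b (posline c A) `<=` posline c (posline b A).
Proof.
move=> bA y /=; apply: contraPP => /negP; rewrite -leNgt => y0.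
pose X : set (RT * RT) := [set p | A (y + (p.1 : R) *: b + (p.2 : R) *: c)].
have mX : measurable X.
  pose h (p : RT * RT) : BT * RT := (y + (p.1 : R) *: b, p.2).
  have mh : measurable_fun setT h.
    apply/measurable_fun_pairP; split; last exact: measurable_snd.
    rewrite (_ : fst \o h = (fun q : BT * RT => (q.1 : V) + (q.2 : R) *: b : BT)
      \o (pair (y : BT)) \o fst)//.
    apply: measurableT_comp; last exact: measurable_fst.
    by apply: measurableT_comp (measurable_shift b) _; exact: pair1_measurable.
  have := mh measurableT _ (measurable_shift_preimage c bA).
  by rewrite setTI.
have Xx s : xsection X s = [set t : R | A (y + s *: b + t *: c)].
  by apply/seteqP; split => t; rewrite /xsection/= inE.
have Xy t : ysection X t = [set s : R | A (y + t *: c + s *: b)].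
  by apply/seteqP; split => s; rewrite /ysection/= inE /X/= addrAC.
apply/negP; rewrite -leNgt.
have := null_sections mX.
rewrite (_ : [set t : R | (0 < mu (ysection X t))%E] =
    [set t : R | posline b A (y + t *: c)]); last first.
  by apply/seteqP; split => t; rewrite /posline/= Xy.
rewrite (_ : [set s : R | (0 < mu (xsection X s))%E] =
    [set s : R | posline c A (y + s *: b)]); last first.
  by apply/seteqP; split => s; rewrite /posline/= Xx.
by move=> -> //; apply/eqP; rewrite eq_le y0 measure_ge0.
Qed.

End positive_lines.

Section negligible.
Context {R : realType} {V : normedModType R}.
Notation mu := (@lebesgue_measure R).
Implicit Types (b : V) (bs : seq V) (A : set V).

Definition poslines bs A : set V := foldr posline A bs.

Lemma borel_poslines bs A : borel A -> borel (poslines bs A).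
Proof. by move=> bA; elim: bs => //= b bs ih; exact: borel_posline. Qed.

Lemma posline0 b : posline b (@set0 V) = set0.
Proof.
apply/seteqP; split => // y; rewrite /posline/=.
by rewrite -[X in mu X]/(@set0 R) measure0 ltxx.
Qed.

Lemma poslines0 bs : poslines bs (@set0 V) = set0.
Proof. by elim: bs => //= b bs ->; exact: posline0. Qed.

Lemma poslines_open bs U A : open U -> borel A -> U `<=` A -> U `<=` poslines bs A.
Proof.
move=> oU bA UA; elim: bs => //= b bs ih.
by apply: posline_open => //; exact: borel_poslines.
Qed.

Lemma poslines_comm bs b A : borel A ->
  poslines bs (posline b A) = posline b (poslines bs A).
Proof.
move=> bA; elim: bs => //= c bs ->.
by apply/seteqP; split; apply: posline_comm; exact: borel_poslines.
Qed.

Lemma poslines_bigcup bs (F : nat -> set V) : (forall k, borel (F k)) ->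
  poslines bs (\bigcup_k F k) `<=` \bigcup_k poslines bs (F k).
Proof.
move=> bF; elim: bs => //= b bs ih.
have bpF k : borel (poslines bs (F k)) by exact: borel_poslines.
apply: (@subset_trans _ (posline b (\bigcup_k poslines bs (F k)))).
  apply: posline_sub => //; last exact: bigcupT_measurable.
  by apply: borel_poslines; exact: bigcupT_measurable.
exact: posline_bigcup.
Qed.

(** The null sets of Lebesgue measure on R^n, when [bs] is a basis: iterating
    [posline] plays the part of iterated integration. *)
Definition linenull bs A := exists A', [/\ borel A', A `<=` A' & poslines bs A' = set0].

Lemma linenull_sub bs A A' : A `<=` A' -> linenull bs A' -> linenull bs A.
Proof. by move=> AA' [B [bB A'B B0]]; exists B; split=> //; exact: subset_trans A'B. Qed.

Lemma linenull_bigcup bs (F : nat -> set V) : (forall k, linenull bs (F k)) ->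
  linenull bs (\bigcup_k F k).
Proof.
move=> /choice[G GP]; exists (\bigcup_k G k); split.
- by apply: bigcupT_measurable => k; case: (GP k).
- by apply: subset_bigcup => k _; case: (GP k).
- apply/seteqP; split => // y /poslines_bigcup[|k _].
    by move=> k; case: (GP k).
  by case: (GP k) => _ _ ->.
Qed.

Lemma linenull0 bs : linenull bs set0.
Proof. by exists set0; split => //; [exact: measurable0|exact: poslines0]. Qed.

Lemma linenull_ex (T : countType) bs (P : T -> set V) : (forall i, linenull bs (P i)) ->
  linenull bs [set x | exists i, P i x].
Proof.
move=> nP; pose F k := if @unpickle T k is Some i then P i else set0.
apply: (@linenull_sub _ _ (\bigcup_k F k)).
  by move=> x [i Pix]; exists (pickle i) => //; rewrite /F pickleK.
apply: linenull_bigcup => k; rewrite /F; case: unpickle => //.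
exact: linenull0.
Qed.

(** As the operators commute, the one that empties [A] may be applied first. *)
Lemma linenull_of_null_slices b bs A : borel A ->
  (forall y : V, mu [set s : R | A (y + s *: b)] = 0%E) -> b \in bs -> linenull bs A.
Proof.
move=> bA A0 bbs; exists A; split => //.
have b0 : posline b A = set0.
  by apply/seteqP; split => // y; rewrite /posline/= A0 ltxx.
elim: bs bbs => //= c bs ih; rewrite inE => /orP[/eqP <-|/ih ->]; last exact: posline0.
by rewrite -poslines_comm// b0 poslines0.
Qed.

(** Applying the operators along [bs] to [posline b A] yields the empty set as
    [posline b] may be applied last, but enlarges every open subset. *)
Lemma linenull_open_posline b bs A U : borel A -> poslines bs A = set0 ->
  open U -> U `<=` posline b A -> U = set0.
Proof.
move=> bA A0 oU UA; apply/seteqP; split=> // y Uy.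
have := poslines_open bs oU (borel_posline b bA) UA Uy.
by rewrite poslines_comm// A0 posline0.
Qed.

Lemma linenull_setU bs A A' : linenull bs A -> linenull bs A' -> linenull bs (A `|` A').
Proof.
move=> nA nA'; apply: (@linenull_sub _ _ [set x | exists c : bool, (if c then A else A') x]).
  by move=> x [Ax|Ax]; [exists true|exists false].
by apply: linenull_ex => -[].
Qed.

End negligible.

(** * Rademacher's theorem *)

Section approx_linear.
Context {R : realType} {V : normedModType R}.
Implicit Types (A : set V) (x y p : V).

(** The uniformity over [|t| <= d] makes this set closed, hence Borel, and gives
    the estimates needed at nearby points of the set. *)
Definition slope_set (phi : V -> R) (b : V) (q e d : R) : set V :=
  [set x | forall t, `|t| <= d -> `|phi (x + t *: b) - phi x - t * q| <= e * `|t|].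

Lemma closed_slope_set phi b q e d : continuous phi ->
  closed (slope_set phi b q e d).
Proof.
move=> cphi.
rewrite (_ : slope_set _ _ _ _ _ = \bigcap_(t in [set t : R | `|t| <= d])
   [set x | `|phi (x + t *: b) - phi x - t * q| <= e * `|t|]); last by apply/seteqP; split.
apply: closed_bigI => t _.
apply: (@closed_comp _ _ (fun x => `|phi (x + t *: b) - phi x - t * q|) [set y | y <= e * `|t|]).
  move=> x _; apply: cvg_norm; apply: cvgB; last exact: cvg_cst.
  apply: cvgB; last exact: cphi.
  apply: (@cvg_comp _ _ _ (fun z => z + t *: b) phi); last exact: cphi.
  by apply: cvgD; [exact: cvg_id|exact: cvg_cst].
exact: closed_le.
Qed.

(** Rational slopes and steps, to describe the points of differentiability in the
    direction [b] with countably many closed sets. *)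
Definition approx_slope phi (b : V) x := forall j : nat, exists i : rat * nat,
  slope_set phi b (ratr i.1) j.+1%:R^-1 i.2.+1%:R^-1 x.

(** The exceptional set is contained in a Borel set whose slices in the direction
    [b] are null, by differentiability almost everywhere on each line. *)
Lemma linenull_no_slope (phi : V -> R) L (b : V) bs : lipschitz_with L phi -> b \in bs ->
  linenull bs [set x | ~ approx_slope phi b x].
Proof.
move=> Lphi bbs; have cphi := lip_continuous Lphi.
pose A j : set V := ~` [set x | exists i : rat * nat,
  slope_set phi b (ratr i.1) j.+1%:R^-1 i.2.+1%:R^-1 x].
apply: (@linenull_sub _ _ _ _ (\bigcup_j A j)).
  by move=> x /existsNP[j nj]; exists j.
have bA j : borel (A j).
  apply: measurableC.
  rewrite (_ : [set x | _] = \bigcup_i slope_set phi b (ratr i.1) j.+1%:R^-1 i.2.+1%:R^-1).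
    apply: countable_bigcupT_measurable => // i.
    by apply: closed_borel; exact: closed_slope_set.
  by apply/seteqP; split => x [i]; [exists i|move=> _; exists i].
apply: linenull_bigcup => j; apply: (@linenull_of_null_slices _ _ b) => // y.
pose h s := phi (y + s *: b).
have Lh : lipschitz_with (`|L| * `|b|) h.
  move=> s t; rewrite /h (le_trans (Lphi _ _))//.
  rewrite opprD addrACA subrr add0r -scalerBl normrZ mulrAC -mulrA.
  by rewrite ler_wpM2r ?mulr_ge0// ler_norm.
apply: measure_negligible; first exact: measurable_line.
have [N [mN N0 sN]] := lip_ae_derivable Lh.
exists N; split => // s /= As; apply: sN => /= dh; apply: As.
have /cvg_ex[/= l hl] := dh.
have j0 : 0 < j.+1%:R^-1 / 2 :> R by rewrite divr_gt0.
have [q] := @rat_in_itvoo R _ _ (ltr_pwDr j0 (lexx l)).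
rewrite in_itv/= => /andP[lq ql].
move/cvgrPdist_le : hl => /(_ _ j0) /nbhs_ballP[e /= e0 eU].
have [k ke] : exists k : nat, k.+1%:R^-1 < e.
  by have [k _ /(_ _ (leqnn k))] := near_infty_natSinv_lt (PosNum e0); exists k.
exists (q, k) => t /= tk.
have [->|t0] := eqVneq t 0.
  by rewrite scale0r addr0 mul0r !subr0 subrr normr0 mulr0.
have := eU t; rewrite -ball_normE /= sub0r normrN => /(_ (le_lt_trans tk ke) t0).
rewrite /h /= (_ : y + (t *: (1 : R) + s) *: b = y + s *: b + t *: b); last first.
  by rewrite -[t *: (1 : R)]/(t * 1) mulr1 scalerDl addrA addrAC.
rewrite -[_ *: (_ - _)]/(_ * (_ - _)) => hl.
set D := phi _ - phi _ in hl *.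
have -> : D - t * ratr q = - (t * (l - t^-1 * D)) + t * (l - ratr q) by field.
rewrite (le_trans (ler_normD _ _))// normrN !normrM mulrC [`|t| * `|_ - ratr q|]mulrC -mulrDl.
rewrite ler_wpM2r// (splitr j.+1%:R^-1) lerD//.
by rewrite distrC gtr0_norm ?subr_gt0// lerBlDl ltW.
Qed.

Definition set_dist (A : set V) (x : V) : R := inf [set `|x - p| | p in A].

Lemma has_inf_dist A x : A !=set0 -> has_inf [set `|x - p| | p in A].
Proof. by move=> [p Ap]; split; [exists `|x - p|; exists p|exists 0 => _ [q _ <-]]. Qed.

Lemma set_dist_ge0 A x : A !=set0 -> 0 <= set_dist A x.
Proof. by move=> [p Ap]; apply: lb_le_inf; [exists `|x - p|; exists p|move=> _ [q _ <-]]. Qed.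

Lemma set_dist_le A x p : A p -> set_dist A x <= `|x - p|.
Proof. by move=> Ap; apply: ge_inf; [exists 0 => _ [q _ <-]|exists p]. Qed.

Lemma set_dist_approx A x (e : R) : A !=set0 -> 0 < e ->
  exists2 p, A p & `|x - p| < set_dist A x + e.
Proof.
move=> A0 e0; have [_ [p Ap <-] pe] := inf_adherent e0 (has_inf_dist x A0).
by exists p.
Qed.

Lemma lip_set_dist A : A !=set0 -> lipschitz_with 1 (set_dist A).
Proof.
move=> A0.
have H x y : set_dist A x <= set_dist A y + `|x - y|.
  apply/ler_addgt0Pr => e e0; have [p Ap pe] := set_dist_approx y A0 e0.
  rewrite (le_trans (set_dist_le x Ap))// (le_trans (ler_distD y _ _))//; lra.
move=> x y; rewrite mul1r ler_norml; apply/andP; split.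
  by have := H y x; rewrite distrC; lra.
by have := H x y; lra.
Qed.

End approx_linear.

Section sup_norm.
Context {R : realType}.

Lemma coord_le_norm m n (M : 'M[R]_(m, n)) i j : `|M i j| <= `|M|.
Proof. by rewrite [leRHS]/Num.norm/= mx_normrE; apply: (le_bigmax _ _ (i, j)). Qed.

Lemma norm_le_coord m n (M : 'M[R]_(m, n)) (c : R) : 0 <= c ->
  (forall i j, `|M i j| <= c) -> `|M| <= c.
Proof.
move=> c0 Mc; rewrite [leLHS]/Num.norm/= mx_normrE.
by apply/bigmax_leP; split => // -[i j] _; exact: Mc.
Qed.

Context {n : nat}.
Implicit Types u v w x : 'cV[R]_n.

Lemma dotDl u v w : dot (u + v) w = dot u w + dot v w.
Proof. by rewrite /dot -big_split; apply: eq_bigr => i _; rewrite mxE mulrDl. Qed.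

Lemma dotZl a u w : dot (a *: u) w = a * dot u w.
Proof. by rewrite /dot mulr_sumr; apply: eq_bigr => i _; rewrite mxE mulrA. Qed.

Lemma dotC u v : dot u v = dot v u.
Proof. by apply: eq_bigr => i _; rewrite mulrC. Qed.

Lemma dotDr u v w : dot w (u + v) = dot w u + dot w v.
Proof. by rewrite dotC dotDl !(dotC _ w). Qed.

Lemma dotZr a u w : dot w (a *: u) = a * dot w u.
Proof. by rewrite dotC dotZl (dotC _ w). Qed.

Lemma dotNr u w : dot w (- u) = - dot w u.
Proof. by rewrite -scaleN1r dotZr mulN1r. Qed.

Definition ebase (i : 'I_n) : 'cV[R]_n := delta_mx i ord0.

Lemma dot_ebase i v : dot (ebase i) v = v i ord0.
Proof.
rewrite /dot (bigD1 i)//= big1 ?addr0 ?mxE ?eqxx ?mul1r// => j ji.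
by rewrite mxE (negbTE ji) mul0r.
Qed.

Lemma dot_le u v : `|dot u v| <= (\sum_(i < n) `|u i ord0|) * `|v|.
Proof.
rewrite (le_trans (ler_norm_sum _ _ _))// mulr_suml; apply: ler_sum => i _.
by rewrite normrM ler_wpM2l// coord_le_norm.
Qed.

Definition ebases := [seq ebase i | i <- enum 'I_n].

Lemma mem_ebases i : ebase i \in ebases.
Proof. by apply: map_f; rewrite mem_enum. Qed.

End sup_norm.

Section rademacher.
Context {R : realType} {n : nat}.
Notation V := 'cV[R]_n.
Implicit Types (phi : V -> R) (x h : V).

(** Differentiability at [x] along the first [k] coordinates, in a form that lets
    the linear map [a] depend on the precision [e]: no convergence has to be
    proved before the last step. *)
Definition approx_linear (k : nat) phi x := forall e, 0 < e ->
  exists a : V, exists2 d : R, 0 < d & forall h : V,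
    (forall i : 'I_n, (k <= i)%N -> h i ord0 = 0) -> `|h| <= d ->
    `|phi (x + h) - phi x - dot a h| <= e * `|h|.

(** The distance to [A] is nonnegative and vanishes at [x]. Comparing its linear
    approximations at [h] and [- h] shows that the linear part is small, so that
    the distance of [x + h] to [A] is small compared with [h]. *)
Lemma approx_linear_dist k (A : set V) x e : A x -> approx_linear k (set_dist A) x ->
  0 < e -> exists2 d : R, 0 < d & forall h : V,
    (forall i : 'I_n, (k <= i)%N -> h i ord0 = 0) -> `|h| <= d ->
    exists2 p, A p & `|x + h - p| <= e * `|h|.
Proof.
move=> Ax Al e0; have A0 : A !=set0 by exists x.
have dx : set_dist A x = 0.
  apply/eqP; rewrite eq_le set_dist_ge0// andbT.
  by rewrite (le_trans (set_dist_le x Ax))// subrr normr0.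
have e3 : 0 < e / 3 by rewrite divr_gt0.
have [a [d d0 ad]] := Al _ e3; exists d => // h hk hd.
have [->|h0] := eqVneq h 0.
  by exists x => //; rewrite addr0 subrr !normr0 mulr0.
have nh0 : 0 < `|h| by rewrite normr_gt0.
have := ad (- h); rewrite normrN dotNr => /(_ _ hd) adN.
have {}adN : `|set_dist A (x - h) - set_dist A x + dot a h| <= e / 3 * `|h|.
  by rewrite -[dot a h]opprK; apply: adN => i ki; rewrite mxE hk ?oppr0.
have hN := set_dist_ge0 (x - h) A0.
have a1 := le_trans (ler_norm _) adN; have a2 := le_trans (ler_norm _) (ad _ hk hd).
have [p Ap pe] := set_dist_approx (x + h) A0 (mulr_gt0 e3 nh0).
exists p => //; rewrite (le_trans (ltW pe))//.
have -> : e * `|h| = e / 3 * `|h| + e / 3 * `|h| + e / 3 * `|h| by field.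
lra.
Qed.

(** To move from [x] by [h + t e_k] with [h] in the first [k] coordinates, replace
    [x + h] by a close point [p] of a slope set containing [x]: the error is
    [o(h)] by the Lipschitz property, and the slope in the direction [e_k] at [p]
    is the one at [x]. *)
Lemma approx_linearS (k : 'I_n) phi L x : lipschitz_with L phi ->
  approx_slope phi (ebase k) x -> approx_linear k phi x ->
  (forall j i, slope_set phi (ebase k) (ratr i.1) j.+1%:R^-1 i.2.+1%:R^-1 x ->
     approx_linear k (set_dist (slope_set phi (ebase k) (ratr i.1) j.+1%:R^-1 i.2.+1%:R^-1)) x) ->
  approx_linear k.+1 phi x.
Proof.
move=> Lphi sl Al Ad e e0.
(* the four error terms are two of Lipschitz type and two of size [e'] *)
pose C := 2 * `|L| + 2; have C0 : 0 < C by rewrite ltr_wpDl// mulr_ge0.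
pose e' := e / C; have e'0 : 0 < e' by rewrite divr_gt0.
have [j je] : exists j : nat, j.+1%:R^-1 < e'.
  by have [j _ /(_ _ (leqnn j))] := near_infty_natSinv_lt (PosNum e'0); exists j.
have [[q m] /= xE] := sl j; have Alx := Ad j (q, m) xE.
set E := slope_set _ _ _ _ _ in xE Alx.
have [d1 d10 hd1] := approx_linear_dist xE Alx e'0.
have [a [d2 d20 hd2]] := Al _ e'0.
pose d := Num.min d1 (Num.min d2 m.+1%:R^-1).
(* the linear map [a] with its coordinate [k] replaced by the slope [q] *)
exists (a + (ratr q - a k ord0) *: ebase k); exists d.
  by rewrite !lt_min d10 d20/=.
move=> v vk; rewrite !le_min => /andP[vd1 /andP[vd2 vm]].
pose t := v k ord0; pose h := v - t *: ebase k.
have vE : v = h + t *: ebase k by rewrite subrK.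
have hk0 : h k ord0 = 0 by rewrite !mxE eqxx mulr1 subrr.
have hi (i : 'I_n) : i != k -> h i ord0 = v i ord0.
  by move=> ik; rewrite !mxE (negbTE ik)/= mulr0 subr0.
have tv : `|t| <= `|v| by exact: coord_le_norm.
have hv : `|h| <= `|v|.
  apply: norm_le_coord => // i j'; rewrite ord1.
  have [->|ik] := eqVneq i k; first by rewrite hk0 normr0.
  by rewrite hi// coord_le_norm.
have hk (i : 'I_n) : (k <= i)%N -> h i ord0 = 0.
  move=> ki; have [->//|ik] := eqVneq i k; rewrite hi// vk//.
  by rewrite ltn_neqAle ki andbT eq_sym.
have -> : dot (a + (ratr q - a k ord0) *: ebase k) v = dot a h + t * ratr q.
  rewrite dotDl dotZl dot_ebase -/t {1}vE dotDr dotZr (dotC a (ebase k)) dot_ebase; ring.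
have [p Ep pe] := hd1 h hk (le_trans hv vd1).
have H2 := hd2 h hk (le_trans hv vd2).
have H3 := Ep t (le_trans tv vm).
have H1 := Lphi (x + v) (p + t *: ebase k).
have H4 := Lphi p (x + h).
have xvp : x + v - (p + t *: ebase k) = x + h - p.
  by rewrite {1}vE addrA opprD addrACA subrr addr0.
rewrite xvp in H1; rewrite [`|p - _|]distrC in H4.
have pv : `|x + h - p| <= e' * `|v| by rewrite (le_trans pe)// ler_wpM2l// ltW.
have Lpv : L * `|x + h - p| <= `|L| * (e' * `|v|).
  by rewrite (le_trans (ler_norm _))// normrM normr_id ler_wpM2l.
have {}H1 := le_trans H1 Lpv; have {}H4 := le_trans H4 Lpv.
have {}H2 : `|phi (x + h) - phi x - dot a h| <= e' * `|v|.
  by rewrite (le_trans H2)// ler_wpM2l// ltW.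
have {}H3 : `|phi (p + t *: ebase k) - phi p - t * ratr q| <= e' * `|v|.
  by rewrite (le_trans H3)// ler_pM// ltW.
have -> : phi (x + v) - phi x - (dot a h + t * ratr q) =
  (phi (x + v) - phi (p + t *: ebase k)) +
  (phi (p + t *: ebase k) - phi p - t * ratr q) + (phi p - phi (x + h)) +
  (phi (x + h) - phi x - dot a h) by ring.
have -> : e * `|v| = `|L| * (e' * `|v|) + e' * `|v| + `|L| * (e' * `|v|) + e' * `|v|.
  have -> : e = C * e' by rewrite /e' mulrC divfK// gt_eqF.
  rewrite /C; ring.
rewrite (le_trans (ler_normD _ _))// lerD//.
rewrite (le_trans (ler_normD _ _))// lerD//.
by rewrite (le_trans (ler_normD _ _))// lerD.
Qed.

(** Countably many slope sets are involved, and the induction hypothesis applies to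
    the distance to each of them. *)
Lemma linenull_not_approx_linear k : (k <= n)%N -> forall phi L, lipschitz_with L phi ->
  linenull ebases [set x | ~ approx_linear k phi x].
Proof.
elim: k => [_|k ih kn] phi L Lphi.
  apply: linenull_sub (linenull0 _) => x /=; apply => e e0; exists 0, 1 => // h h0 _.
  have -> : h = 0 by apply/colP => i; rewrite h0// mxE.
  by rewrite addr0 subrr -(scale0r (0 : V)) dotZr mul0r subrr normr0 scale0r normr0 mulr0.
pose K := Ordinal kn; have {}ih := ih (ltnW kn).
pose E (i : nat * (rat * nat)) :=
  slope_set phi (ebase K) (ratr i.2.1) i.1.+1%:R^-1 i.2.2.+1%:R^-1.
apply: (@linenull_sub _ _ _ _ (([set x | ~ approx_slope phi (ebase K) x] `|`
   [set x | ~ approx_linear k phi x]) `|`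
   [set x | exists i, E i x /\ ~ approx_linear k (set_dist (E i)) x])).
  move=> x /= nx; apply: contrapT => /not_orP[/not_orP[/contrapT h1 /contrapT h2] h3].
  apply: nx; apply: (@approx_linearS K _ _ _ Lphi h1 h2) => j i Ex.
  by apply: contrapT => nE; apply: h3; exists (j, i).
apply: linenull_setU.
  apply: linenull_setU; last exact: ih Lphi.
  by apply: linenull_no_slope Lphi _; exact: mem_ebases.
apply: linenull_ex => i; have [E0|/set0P E0] := eqVneq (E i) set0.
  by apply: linenull_sub (linenull0 _) => x [Ex]; rewrite -E0.
by apply: linenull_sub (ih _ _ (lip_set_dist E0)) => x [].
Qed.

End rademacher.

Section frechet.
Context {R : realType} {n : nat}.
Notation V := 'cV[R]_n.

Lemma diff_approx (U W : normedModType R) (f : U -> W) (x : U) (e : R) :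
  differentiable f x -> 0 < e -> exists2 d : R, 0 < d & forall h, `|h| < d ->
  `|f (x + h) - f x - 'd f x h| <= e * `|h|.
Proof.
move=> /diff_locallyP[_ /eqaddoP/(_ _)] + e0 => /(_ _ e0) /nbhs_ballP[d /= d0 dU].
exists d => // h hd; have := dU h; rewrite -ball_normE /= sub0r normrN => /(_ hd).
rewrite /= !fctE /= (addrC x h) opprD addrA; apply.
Qed.

Lemma is_diff_approx (U W : normedModType R) (f : U -> W) (df : {linear U -> W}) (x : U) :
  continuous df ->
  (forall e : R, 0 < e -> exists2 d : R, 0 < d & forall h, `|h| <= d ->
     `|f (x + h) - f x - df h| <= e * `|h|) -> is_diff x f df.
Proof.
move=> cdf H.
have fo : f \o shift x = cst (f x) + df +o_ 0 id.
  apply/eqaddoP => e e0; have [d d0 dU] := H e e0.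
  apply/nbhs_ballP; exists d => // h; rewrite -ball_normE /= sub0r normrN => /ltW hd.
  by have := dU h hd; rewrite /= !fctE /= (addrC x h) opprD addrA.
have dE := diff_unique cdf fo.
by apply: DiffDef => //; apply/diff_locallyP; rewrite dE.
Qed.

Lemma dot_linear (a : V) : linear (dot a : V -> R).
Proof. by move=> k u v; rewrite dotDr dotZr. Qed.
HB.instance Definition _ (a : V) := GRing.isLinear.Build R V R _ (dot a) (dot_linear a).

Lemma lip_dot (a : V) : lipschitz_with (\sum_(i < n) `|a i ord0|) (dot a).
Proof. by move=> u v; rewrite -dotNr -dotDr dot_le. Qed.

Lemma norm_ebase i : `|ebase i : V| <= 1.
Proof.
apply: norm_le_coord => // k j; rewrite mxE.
by case: (_ && _); rewrite ?normr1 ?normr0.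
Qed.

(** The linear maps obtained for smaller and smaller precision have coordinates
    that approach the partial derivatives, which exist by Cauchy's criterion. *)
Lemma approx_linear_differentiable (phi : V -> R) x : approx_linear n phi x ->
  differentiable phi x.
Proof.
move=> Al.
have {}Al e : 0 < e -> exists a : V, exists2 d : R, 0 < d &
    (forall h : V, `|h| <= d -> `|phi (x + h) - phi x - dot a h| <= e * `|h|) /\
    (forall i t, t != 0 -> `|t| <= d ->
       `|a i ord0 - t^-1 * (phi (t *: ebase i + x) - phi x)| <= e).
  move=> e0; have [a [d d0 H]] := Al e e0; exists a, d => //.
  have {}H h : `|h| <= d -> `|phi (x + h) - phi x - dot a h| <= e * `|h|.
    by apply: H => // i; rewrite leqNgt ltn_ord.
  split=> // i t t0 td.
  have tn : `|t *: (ebase i : V)| <= `|t| by rewrite normrZ ler_piMr// norm_ebase.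
  have := H _ (le_trans tn td); rewrite dotZr (dotC a) dot_ebase (addrC x) => Ht.
  have -> : a i ord0 - t^-1 * (phi (t *: ebase i + x) - phi x) =
    - t^-1 * (phi (t *: ebase i + x) - phi x - t * a i ord0) by field.
  rewrite normrM normrN normfV ler_pdivrMl ?normr_gt0// [leRHS]mulrC.
  by rewrite (le_trans Ht)// ler_wpM2l// ltW.
have near0 (d : R) : 0 < d -> \forall t \near (0 : R)^', t != 0 /\ `|t| <= d.
  move=> d0; apply/nbhs_ballP; exists d => // t.
  by rewrite -ball_normE /= sub0r normrN => /ltW.
have der i : derivable phi x (ebase i).
  apply: cauchy_cvg; apply: cauchy_exP => e e0.
  have [a [d d0 [_ H]]] := Al (e / 2) (divr_gt0 e0 (@ltr0n R 2)).
  exists (a i ord0); apply: filterS (near0 _ d0) => t [t0 td].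
  by rewrite -ball_normE /=; rewrite (le_lt_trans (H _ _ t0 td))// ltr_pdivrMr// ltr_pMr// ltr1n.
pose p : V := \col_i 'D_(ebase i) phi x.
have [] // : is_diff x phi (dot p).
apply: is_diff_approx; first exact: lip_continuous (lip_dot p).
move=> e e0; pose e' := e / n.+1%:R; have e'0 : 0 < e' by rewrite divr_gt0.
have [a [d d0 [H Hp]]] := Al _ e'0; exists d => // h hd.
have ap i : `|a i ord0 - p i ord0| <= e'.
  apply/ler_addgt0Pr => eta eta0; rewrite mxE.
  have /cvgrPdist_le/(_ _ eta0) Hl := der i.
  have [t [[t0 td] tl]] := filter_ex (filterI (near0 _ d0) Hl).
  rewrite (le_trans (ler_distD (t^-1 * (phi (t *: ebase i + x) - phi x)) _ _))//.
  by rewrite lerD// ?Hp// distrC.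
have -> : phi (x + h) - phi x - dot p h =
    (phi (x + h) - phi x - dot a h) + dot (a - p) h.
  by rewrite dotDl (dotC (- p)) dotNr (dotC h p); ring.
rewrite (le_trans (ler_normD _ _))//.
have -> : e * `|h| = e' * `|h| + n%:R * e' * `|h|.
  have {1}-> : e = n.+1%:R * e' by rewrite mulrC divfK.
  by rewrite -natr1; ring.
rewrite lerD ?H// (le_trans (dot_le _ _))// ler_wpM2r//.
apply: (@le_trans _ _ (\sum_(i < n) e')).
  by apply: ler_sum => i _; rewrite [(a - p) i _]mxE [(- p) i _]mxE.
by rewrite sumr_const card_ord mulr_natl.
Qed.

Theorem rademacher (phi : V -> R) L : lipschitz_with L phi ->
  linenull ebases [set x | ~ differentiable phi x].
Proof.
move=> Lphi; apply: linenull_sub (linenull_not_approx_linear (leqnn n) Lphi) => x nd /= Al.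
by apply: nd; exact: approx_linear_differentiable.
Qed.

Lemma differentiable_cV (m : nat) (F : V -> 'cV[R]_m) x :
  (forall i, differentiable (fun y => F y i ord0) x) -> differentiable F x.
Proof.
move=> dF.
rewrite (_ : F = \sum_(i < m) (fun y => F y i ord0 *: (delta_mx i ord0 : 'cV[R]_m))).
  by apply: differentiable_sum => i; exact: differentiableZl.
apply/funext => y; rewrite fct_sumE; apply/colP => j.
rewrite summxE (bigD1 j)//= big1 ?addr0 ?mxE ?eqxx ?mulr1// => i ij.
by rewrite !mxE eq_sym (negbTE ij) mulr0.
Qed.

Theorem rademacher_cV (m : nat) (F : V -> 'cV[R]_m) L : lipschitz_with L F ->
  linenull ebases [set x | ~ differentiable F x].
Proof.
move=> LF.
apply: (@linenull_sub _ _ _ _ [set x | exists i, ~ differentiable (fun y => F y i ord0) x]).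
  by move=> x nd; apply/existsNP => dF; apply: nd; exact: differentiable_cV.
apply: linenull_ex => i; apply: (@rademacher _ L) => x y.
by rewrite (le_trans _ (LF x y))// (le_trans _ (coord_le_norm _ i ord0))// !mxE.
Qed.

End frechet.

(** * A mean value inequality *)

Section mean_value.
Context {R : realType} {n : nat}.
Notation V := 'cV[R]_n.
Notation mu := (@lebesgue_measure R).

Lemma diff_dot (m : nat) (F : V -> 'cV[R]_m) (w : 'cV[R]_m) z : differentiable F z ->
  is_diff z (fun y => dot w (F y)) (fun v => dot w ('d F z v)).
Proof.
move=> dF.
have cw : continuous (dot w) := lip_continuous (lip_dot w).
have dw : differentiable (dot w) (F z) by exact: linear_differentiable.
apply: DiffDef; first exact: differentiable_comp.
rewrite (_ : (fun y => dot w (F y)) = dot w \o F)// diff_comp//.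
by rewrite (diff_lin _ cw).
Qed.

Lemma is_derive_line (g : V -> R) (y u : V) (s : R) :
  differentiable g (y + s *: u) ->
  is_derive s 1 (fun t : R => g (y + t *: u)) ('d g (y + s *: u) u).
Proof.
move=> dg; have dgu := @diff_derivable _ _ _ _ _ u dg.
have E : (fun e : R =>
      e^-1 *: (((fun t => g (y + t *: u)) \o shift s) (e *: (1 : R)) - g (y + s *: u))) =
    (fun e : R => e^-1 *: ((g \o shift (y + s *: u)) (e *: u) - g (y + s *: u))).
  apply/funext => e; rewrite /= (_ : y + (e *: (1 : R) + s) *: u = e *: u + (y + s *: u))//.
  by rewrite -[e *: (1 : R)]/(e * 1) mulr1 scalerDl addrCA.
by apply: DeriveDef; [rewrite /derivable E|rewrite -deriveE// /derive E].
Qed.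

(** Otherwise the derivative of [<w, F>] in the direction [u] is at most [c] at
    every point near [y] where [F] is differentiable. The segments close to the one
    from [y] to [y + t u] carry an increment larger than [c t], so each of them
    meets the exceptional set in positive length: an open set of such lines
    contradicts Rademacher's theorem. *)
Lemma mean_value_diff (m : nat) (F : V -> 'cV[R]_m) L (w : 'cV[R]_m) (u y : V) (t c r : R) :
  lipschitz_with L F -> 0 < t -> `|t *: u| < r ->
  c * t < dot w (F (y + t *: u)) - dot w (F y) ->
  exists z, [/\ `|z - y| < r, differentiable F z & c <= dot w ('d F z u)].
Proof.
move=> LF t0 tr ct; apply: contrapT => nz.
have {}nz z : `|z - y| < r -> differentiable F z -> dot w ('d F z u) <= c.
  move=> zr dF; rewrite leNgt; apply/negP => cz; apply: nz; exists z.
  by split => //; exact: ltW.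
have [A [bA sA A0]] := rademacher_cV LF.
pose W := \sum_(i < m) `|w i ord0|.
pose g z := dot w (F z).
have Lg : lipschitz_with (W * `|L|) g.
  move=> p q; rewrite /g -dotNr -dotDr (le_trans (dot_le _ _))// -mulrA.
  by rewrite ler_wpM2l ?sumr_ge0// (le_trans (LF _ _))// ler_wpM2r// ler_norm.
have cg : continuous g := lip_continuous Lg.
(* the starting points of the segments parallel and close to the given one *)
pose U := [set y' : V | c * t < g (y' + t *: u) - g y'] `&`
  [set y' : V | `|y' - y| < r - `|t *: u|].
have oU : open U.
  apply: openI.
    have cf : continuous (fun y' : V => g (y' + t *: u) - g y').
      apply: (@lip_continuous _ _ _ (W * `|L| + W * `|L|)) => p q.
      rewrite (_ : _ - _ = (g (p + t *: u) - g (q + t *: u)) - (g p - g q)); last by ring.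
      rewrite (le_trans (ler_normB _ _))// mulrDl lerD// (le_trans (Lg _ _))//.
      by rewrite opprD addrACA subrr addr0.
    by have /continuousP/(_ _ (@open_gt R (c * t))) := cf.
  have cf : continuous (fun y' : V => `|y' - y|).
    apply: (@lip_continuous _ _ _ 1) => p q.
    rewrite (le_trans (ler_dist_dist _ _))// mul1r.
    by rewrite opprB addrA subrK.
  by have /continuousP/(_ _ (@open_lt R (r - `|t *: u|))) := cf.
have Uy : U y by split => //=; rewrite subrr normr0 subr_gt0.
suff UA : U `<=` posline u A.
  by have := linenull_open_posline bA A0 oU UA; move=> /seteqP[/(_ _ Uy)].
move=> y' [/= ct' yr']; rewrite /posline/=; apply: contrapT => /negP; rewrite -leNgt => N0.
have {}N0 : mu [set s : R | A (y' + s *: u)] = 0%E by apply/eqP; rewrite eq_le N0 measure_ge0.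
pose h s := g (y' + s *: u).
have Lh : lipschitz_with (W * `|L| * `|u|) h.
  move=> s s'; rewrite /h (le_trans (Lg _ _))// opprD addrACA subrr add0r -scalerBl normrZ.
  by rewrite mulrA mulrAC.
have := @lip_mean_value R h _ c 0 t t0 Lh; rewrite /h scale0r addr0 subr0.
have /[swap] /[apply] : {ae mu, forall s : R,
    s \in `]0, t[ -> derivable h s 1 -> h^`()%classic s <= c}.
  exists [set s : R | A (y' + s *: u)]; split => //; first exact: measurable_line.
  move=> s /= ns; apply: sA => dF; apply: ns; rewrite in_itv/= => /andP[s0 st] _.
  have [dg dgE] := diff_dot w dF.
  rewrite (_ : h^`()%classic s = dot w ('d F (y' + s *: u) u)).
    apply: nz => //; rewrite addrAC (le_lt_trans (ler_normD _ _))// -ltrBrDr.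
    rewrite (lt_le_trans yr')// lerD2l lerN2 !normrZ ler_wpM2r// !gtr0_norm//.
    exact: ltW.
  have [_ hE] := is_derive_line dg.
  by rewrite derive1E hE dgE.
by move=> h0; move: ct'; rewrite ltNge h0.
Qed.

End mean_value.

(** * Symmetry of the Hessian *)

Section symmetry.
Context {R : realType} {n : nat}.
Notation V := 'cV[R]_n.

Lemma cV_sum_ebase (v : V) : v = \sum_(i < n) v i ord0 *: ebase i.
Proof.
apply/colP => j; rewrite summxE (bigD1 j)//= big1 ?addr0 ?mxE ?eqxx ?mulr1// => i ij.
by rewrite !mxE eq_sym (negbTE ij) mulr0.
Qed.

Lemma diff_gradient (g : V -> R) (x v : V) : 'd g x v = dot (gradient g x) v.
Proof.
rewrite {1}[v]cV_sum_ebase linear_sum /dot; apply: eq_bigr => i _.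
by rewrite linearZ mxE mulrC.
Qed.

Lemma is_derive_gradient_line (g : V -> R) (y u : V) (s : R) :
  differentiable g (y + s *: u) ->
  is_derive s 1 (fun t : R => g (y + t *: u)) (dot u (gradient g (y + s *: u))).
Proof. by move=> dg; rewrite dotC -diff_gradient; exact: is_derive_line. Qed.

Lemma hessian_mul (f : V -> R) (x v : V) : hessian f x *m v = 'd (gradient f) x v.
Proof.
rewrite [v in RHS]cV_sum_ebase linear_sum; apply/colP => i.
rewrite summxE mxE; apply: eq_bigr => j _.
by rewrite linearZ !mxE mulrC.
Qed.

(** The second difference is the increment of [s |-> f (z + tv + su) - f (z + su)],
    whose derivative the expansion of the gradient at [z] controls. *)
Lemma second_difference (f : V -> R) (z u v : V) (e : R) :
  (forall x, differentiable f x) -> differentiable (gradient f) z -> 0 < e ->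
  exists2 d : R, 0 < d & forall t, 0 < t -> t < d ->
  `|f (z + t *: u + t *: v) - f (z + t *: u) - f (z + t *: v) + f z
     - t * t * dot u (hessian f z *m v)|
    <= t * t * (e * ((\sum_(i < n) `|u i ord0|) * (2 * (`|u| + `|v|)))).
Proof.
move=> df dG e0; set C := \sum_(i < n) _.
have [d d0 dU] := diff_approx dG e0.
pose N := `|u| + `|v| + 1; have N0 : 0 < N by rewrite ltr_wpDl// addr_ge0.
exists (d / N); first by rewrite divr_gt0.
move=> t t0; rewrite ltr_pdivlMr// => td.
pose phi s := f (z + t *: v + s *: u) - f (z + s *: u).
pose dphi s := dot u (gradient f (z + t *: v + s *: u) - gradient f (z + s *: u)).
have dphiE (s : R) : is_derive s 1 phi (dphi s).
  have D1 := is_derive_gradient_line (df (z + t *: v + s *: u)).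
  have D2 := is_derive_gradient_line (df (z + s *: u)).
  by rewrite /dphi dotDr dotNr; exact: (@is_deriveB R R R _ _ s 1 _ _ D1 D2).
have cphi : {within `[0, t], continuous phi}.
  apply: continuous_subspaceT => s; apply: differentiable_continuous.
  by apply/derivable1_diffP; have [] := dphiE s.
have [s] := @MVT R phi dphi 0 t t0 (fun x _ => dphiE x) cphi.
rewrite in_itv/= subr0 => /andP[s0 st] phiE.
have -> : f (z + t *: u + t *: v) - f (z + t *: u) - f (z + t *: v) + f z = dphi s * t.
  by rewrite -phiE /phi !scale0r !addr0 (addrAC z); ring.
have -> : dphi s * t - t * t * dot u (hessian f z *m v) =
  t * dot u (gradient f (z + t *: v + s *: u) - gradient f (z + s *: u) - 'd (gradient f) z (t *: v)).
  have -> : 'd (gradient f) z (t *: v) = t *: (hessian f z *m v).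
    by rewrite linearZ hessian_mul.
  rewrite dotDr dotNr dotZr -/(dphi s).
  by move: (dphi s) (dot u _) => X Y; ring.
rewrite normrM gtr0_norm// -[leRHS]mulrA ler_wpM2l// ?(ltW t0)//.
rewrite (le_trans (dot_le _ _))// -/C.
have -> : t * (e * (C * (2 * (`|u| + `|v|)))) = C * (e * (t * (2 * (`|u| + `|v|)))) by ring.
rewrite ler_wpM2l ?sumr_ge0//.
have su : `|s *: u| <= t * `|u| by rewrite normrZ gtr0_norm// ler_wpM2r// ltW.
have stuv : `|t *: v + s *: u| <= t * (`|u| + `|v|).
  by rewrite (le_trans (ler_normD _ _))// normrZ gtr0_norm// mulrDr addrC lerD.
have tN : t * (`|u| + `|v|) < d by rewrite (lt_trans _ td)// ltr_pM2l// /N ltrDl.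
have tu : t * `|u| <= t * (`|u| + `|v|) by rewrite ler_pM2l// lerDl.
have H1 := dU _ (le_lt_trans stuv tN).
have H2 := dU _ (le_lt_trans su (le_lt_trans tu tN)).
set G := gradient f in H1 H2 *.
have -> : G (z + t *: v + s *: u) - G (z + s *: u) - 'd G z (t *: v) =
  (G (z + (t *: v + s *: u)) - G z - 'd G z (t *: v + s *: u)) -
  (G (z + s *: u) - G z - 'd G z (s *: u)).
  have vecE (a b c d' g : V) : a - b - c = (a - g - (c + d')) - (b - g - d').
    by apply/colP => i; rewrite !mxE; ring.
  have -> : 'd G z (t *: v + s *: u) = 'd G z (t *: v) + 'd G z (s *: u) by exact: linearD.
  by rewrite addrA; exact: vecE.
rewrite (le_trans (ler_normB _ _))//.
have -> : e * (t * (2 * (`|u| + `|v|))) = e * (t * (`|u| + `|v|)) + e * (t * (`|u| + `|v|)) by ring.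
rewrite lerD// ?(le_trans H1) ?(le_trans H2)// ler_pM2l//.
exact: le_trans su tu.
Qed.

(** The second difference is symmetric in [u] and [v]. *)
Lemma hessian_sym (f : V -> R) (z u v : V) :
  (forall x, differentiable f x) -> differentiable (gradient f) z ->
  dot u (hessian f z *m v) = dot v (hessian f z *m u).
Proof.
move=> df dG; apply/eqP; rewrite -subr_eq0 -normr_le0; apply/ler_addgt0Pr => e e0.
rewrite add0r.
set a := dot u _; set b := dot v _.
pose Cu := (\sum_(i < n) `|u i ord0|) * (2 * (`|u| + `|v|)).
pose Cv := (\sum_(i < n) `|v i ord0|) * (2 * (`|v| + `|u|)).
have Cu0 : 0 <= Cu by rewrite mulr_ge0 ?sumr_ge0// mulr_ge0// addr_ge0.
have Cv0 : 0 <= Cv by rewrite mulr_ge0 ?sumr_ge0// mulr_ge0// addr_ge0.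
have C0 : 0 < Cu + Cv + 1 by rewrite ltr_wpDl// addr_ge0.
pose e' := e / (Cu + Cv + 1); have e'0 : 0 < e' by rewrite divr_gt0.
have [d1 d10 H1] := second_difference u v df dG e'0.
have [d2 d20 H2] := second_difference v u df dG e'0.
pose t := Num.min d1 d2 / 2.
have m0 : 0 < Num.min d1 d2 by rewrite lt_min d10 d20.
have t0 : 0 < t by rewrite divr_gt0.
have : t < Num.min d1 d2 by rewrite ltr_pdivrMr// ltr_pMr// ltr1n.
rewrite lt_min => /andP[t1 t2].
have {}H1 := H1 t t0 t1; have {}H2 := H2 t t0 t2.
rewrite -/a -/Cu in H1; rewrite -/b -/Cv in H2.
set D := _ + f z in H1.
have DE : f (z + t *: v + t *: u) - f (z + t *: v) - f (z + t *: u) + f z = D.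
  by rewrite /D (addrAC z); ring.
rewrite DE in H2.
have tt0 : 0 < t * t by rewrite mulr_gt0.
rewrite -(ler_pM2l tt0) -{1}(gtr0_norm tt0) -normrM.
have -> : t * t * (a - b) = (D - t * t * b) - (D - t * t * a) by ring.
rewrite (le_trans (ler_normB _ _))// (le_trans (lerD H2 H1))// -mulrDr ler_pM2l//.
rewrite -mulrDr /e' mulrAC ler_pdivrMr// ler_pM2l//; lra.
Qed.

End symmetry.

(** * Convex hulls of compact sets *)

Section convex_hull.
Context {R : realType} {V : lmodType R}.

Definition combination (N : nat) (C : set V) : set V :=
  [set x | exists l : 'I_N -> R, exists c : 'I_N -> V,
    [/\ forall i, 0 <= l i, \sum_i l i = 1, forall i, C (c i) &
        x = \sum_i l i *: c i]].

Lemma convex_conv_hull (C : set V) : convex_set (conv_hull C).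
Proof.
move=> x y t; rewrite !inE => hx hy A [cA CA].
by have := cA x y t; rewrite !inE; apply; [exact: hx|exact: hy].
Qed.

Lemma sub_conv_hull (C : set V) : C `<=` conv_hull C.
Proof. by move=> x Cx A [_]; apply. Qed.

Lemma conv_hull_min (C A : set V) : convex_set A -> C `<=` A -> conv_hull C `<=` A.
Proof. by move=> cA CA x; apply. Qed.

Lemma convex_set_combine (A : set V) : convex_set A ->
  forall (t : R) x y, 0 <= t -> t <= 1 -> A x -> A y -> A (t *: x + (1 - t) *: y).
Proof.
move=> cA t x y t0 t1 Ax Ay.
by have := cA x y (Itv01 t0 t1); rewrite !inE => /(_ Ax Ay).
Qed.

Lemma convex_set_intro (A : set V) :
  (forall (t : R) x y, 0 <= t -> t <= 1 -> A x -> A y -> A (t *: x + (1 - t) *: y)) ->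
  convex_set A.
Proof. by move=> H x y t; rewrite !inE => Ax Ay; exact: H. Qed.

Lemma combination_sub_conv (N : nat) (C A : set V) : convex_set A -> C `<=` A ->
  combination N C `<=` A.
Proof.
move=> cA CA; elim: N => [|N ih] x [l [c [l0 l1 cC ->]]].
  by move: l1; rewrite big_ord0 => /esym/eqP; rewrite oner_eq0.
rewrite big_ord_recl; move: l1; rewrite big_ord_recl => l1.
have s0 : 0 <= \sum_(i < N) l (lift ord0 i) by apply: sumr_ge0.
have l01 : l ord0 <= 1 by rewrite -l1 lerDl.
have [le1|ne1] := eqVneq (l ord0) 1.
  have sz : \sum_(i < N) l (lift ord0 i) = 0 by move: l1; rewrite le1; lra.
  have z i : l (lift ord0 i) = 0.
    by apply: (psumr_eq0P _ sz).
  rewrite le1 scale1r big1 ?addr0; first exact/CA.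
  by move=> i _; rewrite z scale0r.
have d0 : 0 < 1 - l ord0 by rewrite subr_gt0 lt_neqAle ne1.
have -> : \sum_(i < N) l (lift ord0 i) *: c (lift ord0 i) =
   (1 - l ord0) *: \sum_(i < N) (l (lift ord0 i) / (1 - l ord0)) *: c (lift ord0 i).
  rewrite scaler_sumr; apply: eq_bigr => i _.
  by rewrite scalerA mulrC divfK// gt_eqF.
apply: (convex_set_combine cA) => //; first exact/CA.
apply: ih; exists (fun i => l (lift ord0 i) / (1 - l ord0)), (fun i => c (lift ord0 i)).
split => // [i|]; first by rewrite divr_ge0// ltW.
by rewrite -mulr_suml -{1}[X in X / _](addKr (l ord0)) l1 addrC divff// gt_eqF.
Qed.

Lemma combination_step (N : nat) (C : set V) a c (t : R) : 0 <= t -> t <= 1 ->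
  combination N C a -> C c -> combination N.+1 C (t *: c + (1 - t) *: a).
Proof.
move=> t0 t1 [l [d [l0 l1 dC ->]]] Cc.
exists (fun i => if unlift ord0 i is Some j then (1 - t) * l j else t).
exists (fun i => if unlift ord0 i is Some j then d j else c).
split => [i| |i|].
- by case: unliftP => // j _; rewrite mulr_ge0// subr_ge0.
- rewrite big_ord_recl unlift_none; under eq_bigr do rewrite liftK.
  by rewrite -mulr_sumr l1 mulr1 addrC subrK.
- by case: unliftP.
- rewrite big_ord_recl unlift_none; under [in RHS]eq_bigr do rewrite liftK.
  by rewrite scaler_sumr; congr (_ + _); apply: eq_bigr => i _; rewrite scalerA.
Qed.

End convex_hull.

Section caratheodory.
Context {R : realType} {n : nat}.
Notation V := 'cV[R]_n.

(** The rows [(c i, 1)] form a matrix with more rows than columns. *)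
Lemma affine_dependence (c : 'I_n.+2 -> V) : exists m : 'I_n.+2 -> R,
  [/\ exists i, m i != 0, \sum_i m i = 0 & \sum_i m i *: c i = 0].
Proof.
pose M : 'M[R]_(n.+2, n + 1) := row_mx (\matrix_(i, j) c i j ord0) (const_mx 1).
have kM : kermx M != 0.
  rewrite kermx_eq0 /row_free neq_ltn; apply/orP; left.
  by rewrite (leq_ltn_trans (rank_leq_col M))// addn1.
pose m := nz_row (kermx M).
have m0 : m != 0 by rewrite nz_row_eq0.
have mM : m *m M = 0 by apply/sub_kermxP; exact: nz_row_sub.
move: mM; rewrite mul_mx_row -row_mx0 => /eq_row_mx[mA mB].
exists (fun i => m ord0 i); split.
- by have /rV0Pn[i] := m0; exists i.
- have := congr1 (fun A : 'rV[R]_1 => A ord0 ord0) mB; rewrite !mxE => mB0; rewrite -[RHS]mB0.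
  by apply: eq_bigr => i _; rewrite mxE mulr1.
- apply/colP => j; have := congr1 (fun A : 'rV[R]_n => A ord0 j) mA; rewrite !mxE => mA0.
  rewrite -[RHS]mA0.
  by rewrite summxE; apply: eq_bigr => i _; rewrite !mxE.
Qed.

(** Caratheodory's argument: subtract the multiple of an affine dependence that
    keeps the coefficients nonnegative and kills one of them. *)
Lemma combination_reduce (C : set V) : combination n.+2 C `<=` combination n.+1 C.
Proof.
move=> x [l [c [l0 l1 cC ->]]].
have [m [[k mk] m0 mc]] := affine_dependence c.
have [i1 mi1] : exists i, 0 < m i.
  apply: contrapT => np; move: mk; apply/negP/negPn/eqP.
  have mle i : m i <= 0 by rewrite leNgt; apply/negP => mi; apply: np; exists i.
  have : \sum_i - m i = 0 by rewrite sumrN m0 oppr0.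
  move=> /psumr_eq0P H; apply/oppr_inj; rewrite oppr0; apply: H => // i _.
  by rewrite oppr_ge0.
(* the first coefficient to vanish when the dependence is subtracted *)
pose i0 := [arg min_(i < i1 | 0 < m i) (l i / m i)]%O.
have [i0m i0min] : 0 < m i0 /\ forall j, 0 < m j -> l i0 / m i0 <= l j / m j.
  by rewrite /i0; case: arg_minP => // i mi H; split.
pose t := l i0 / m i0; have t0 : 0 <= t by rewrite divr_ge0// ltW.
pose l' i := l i - t * m i.
have l'0 i : 0 <= l' i.
  rewrite subr_ge0; have [mi|mi] := ltP 0 (m i).
    by rewrite -ler_pdivlMr// i0min.
  by rewrite (le_trans _ (l0 i))// mulr_ge0_le0.
have l'i0 : l' i0 = 0 by rewrite /l' /t divfK ?subrr// gt_eqF.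
have l'1 : \sum_i l' i = 1 by rewrite sumrB -mulr_sumr m0 mulr0 subr0.
have l'c : \sum_i l i *: c i = \sum_i l' i *: c i.
  under [RHS]eq_bigr do rewrite scalerBl -scalerA.
  by rewrite sumrB -scaler_sumr mc scaler0 subr0.
exists (fun j => l' (lift i0 j)), (fun j => c (lift i0 j)); split => //.
  by rewrite -l'1 [RHS](bigD1_ord i0)//= l'i0 add0r.
by rewrite l'c (bigD1_ord i0)//= l'i0 scale0r add0r.
Qed.

End caratheodory.

Lemma mx_coord_continuous (T : topologicalType) m n i j :
  continuous (fun M : 'M[T]_(m, n) => M i j).
Proof.
move=> M A MA.
exists (fun i' j' => if (i' == i) && (j' == j) then A else setT).
  by move=> i' j'; case: ifP => [/andP[/eqP-> /eqP->]//|_]; exact: filterT.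
by move=> N /(_ i j); rewrite !eqxx.
Qed.

Lemma continuous_sum_ord (T : topologicalType) (R : realType) N (F : 'I_N -> T -> R) :
  (forall i, continuous (F i)) -> continuous (fun x => \sum_i F i x).
Proof.
elim: N F => [|N ih] F cF.
  rewrite (_ : (fun x => _) = cst 0); first exact: cst_continuous.
  by apply/funext => x; rewrite big_ord0.
rewrite (_ : (fun x => _) = (F ord0 + (fun x => \sum_i F (lift ord0 i) x))); last first.
  by apply/funext => x; rewrite big_ord_recl.
by move=> x; apply: continuousD; [exact: cF|exact: ih].
Qed.

Section support.
Context {R : realType} {n : nat}.
Notation V := 'cV[R]_n.

Lemma dot_ge0 (u : V) : 0 <= dot u u.
Proof. by apply: sumr_ge0 => i _; rewrite -expr2 sqr_ge0. Qed.

Lemma dot_eq0 (u : V) : dot u u <= 0 -> u = 0.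
Proof.
move=> u0; have /psumr_eq0P H : dot u u = 0 by apply/eqP; rewrite eq_le u0 dot_ge0.
apply/colP => i; rewrite mxE; apply/eqP; rewrite -sqrf_eq0 expr2; apply/eqP.
by apply: H => // j _; rewrite -expr2 sqr_ge0.
Qed.

Lemma compact_simplex N :
  compact [set l : 'rV[R]_N | (forall i, 0 <= l ord0 i) /\ \sum_i l ord0 i = 1].
Proof.
have cK := @rV_compact R N (fun=> `[0, 1]%classic) (fun=> @segment_compact R 0 1).
apply: (subclosed_compact _ cK) => [|l [l0 l1] i]; last first.
  by rewrite /= in_itv/= l0/= -l1 (bigD1 i)//= lerDl sumr_ge0.
rewrite (_ : [set l | _] = (\bigcap_i [set l : 'rV[R]_N | 0 <= l ord0 i]) `&`
   [set l : 'rV[R]_N | \sum_i l ord0 i = 1]); last first.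
  by apply/seteqP; split => l [/= h ?]; split => // i; [move=> _|]; exact: h.
apply: closedI.
  apply: closed_bigI => i _.
  apply: (@closed_comp _ _ (fun l : 'rV[R]_N => l ord0 i) [set x | 0 <= x]); last exact: closed_ge.
  by move=> l _; exact: mx_coord_continuous.
apply: (@closed_comp _ _ (fun l : 'rV[R]_N => \sum_i l ord0 i) [set x | x = 1]); last exact: closed_eq.
move=> l _; apply: continuous_sum_ord => i; exact: mx_coord_continuous.
Qed.

(** The combinations are the image of a compact set of coefficients and points. *)
Lemma nearest_combination N (C : set V) (v : V) : compact C -> C !=set0 -> (0 < N)%N ->
  exists2 a, combination N C a &
    forall b, combination N C b -> dot (a - v) (a - v) <= dot (b - v) (b - v).
Proof.
move=> cC [c0 Cc0] N0.
pose K := [set l : 'rV[R]_N | (forall i, 0 <= l ord0 i) /\ \sum_i l ord0 i = 1] `*`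
  [set c : 'rV[V]_N | forall i, C (c ord0 i)].
have cK : compact K.
  apply: compact_setX; first exact: compact_simplex.
  exact: (@rV_compact V N (fun=> C) (fun=> cC)).
pose comb (p : 'rV[R]_N * 'rV[V]_N) : V := \sum_i p.1 ord0 i *: p.2 ord0 i.
pose psi p := dot (comb p - v) (comb p - v).
have combK p : K p -> combination N C (comb p).
  by move=> [[l0 l1] pC]; exists (p.1 ord0), (p.2 ord0).
have K0 : K !=set0.
  exists (\row_i (i == Ordinal N0)%:R, const_mx c0); split => /=.
    split=> [i|]; first by rewrite mxE.
    rewrite (bigD1 (Ordinal N0))//= mxE eqxx big1 ?addr0// => i iN.
    by rewrite mxE (negbTE iN).
  by move=> i; rewrite mxE.
have cpsi : continuous psi.
  have cl i : continuous (fun p : 'rV[R]_N * 'rV[V]_N => p.1 ord0 i).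
    move=> p; apply: (@continuous_comp _ _ _ fst (fun l : 'rV[R]_N => l ord0 i)).
      exact: cvg_fst.
    exact: mx_coord_continuous.
  have cc i j : continuous (fun p : 'rV[R]_N * 'rV[V]_N => p.2 ord0 i j ord0).
    move=> p; apply: (@continuous_comp _ _ _ snd (fun c : 'rV[V]_N => c ord0 i j ord0)).
      exact: cvg_snd.
    apply: (@continuous_comp _ _ _ (fun c : 'rV[V]_N => c ord0 i) (fun c : V => c j ord0)).
      exact: mx_coord_continuous.
    exact: mx_coord_continuous.
  have cd j : continuous (fun p => (comb p - v) j ord0).
    have -> : (fun p => (comb p - v) j ord0) =
        (fun p : 'rV[R]_N * 'rV[V]_N => \sum_i p.1 ord0 i * p.2 ord0 i j ord0) - cst (v j ord0).
      apply/funext => p; rewrite [LHS]mxE summxE [(- v) _ _]mxE; congr (_ - _).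
      by apply: eq_bigr => i _; rewrite mxE.
    move=> p; apply: continuousB; last exact: cst_continuous.
    apply: continuous_sum_ord => i q; apply: continuousM; [exact: cl|exact: cc].
  by apply: continuous_sum_ord => j p; apply: continuousM; exact: cd.
have [p pK pmin] := compact_EVT_min K0 cK (continuous_subspaceT cpsi).
exists (comb p); first by apply: combK; rewrite -in_setE.
move=> _ [l [c [l0 l1 cC' ->]]].
have := pmin (\row_i l i, \row_i c i).
rewrite /psi (_ : comb (_, _) = \sum_i l i *: c i); last first.
  by apply: eq_bigr => i _; rewrite !mxE.
apply; rewrite inE; split => /=; last by move=> i; rewrite mxE.
split=> [i|]; first by rewrite mxE.
by under eq_bigr do rewrite mxE.
Qed.

(** The point [a] of the hull closest to [v] is [v] itself: otherwise
    [u = v - a] has a larger product with some [c] of [C] than with [a], and moving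
    from [a] towards [c] comes closer to [v]. Caratheodory's theorem keeps the
    moved point among the combinations over which [a] is closest. *)
Theorem mem_conv_hull_of_support (C : set V) (v : V) : compact C ->
  (forall u, exists2 c, C c & dot u v <= dot u c) -> conv_hull C v.
Proof.
move=> cC sup; have C0 : C !=set0 by have [c Cc _] := sup 0; exists c.
have [a aC amin] := nearest_combination v cC C0 (ltn0Sn n).
suff -> : v = a.
  by apply: (combination_sub_conv (@convex_conv_hull _ _ C) (@sub_conv_hull _ _ C)) aC.
apply/eqP; rewrite -subr_eq0; apply/eqP; apply: dot_eq0.
set u := v - a; have [c Cc uc] := sup u.
set w := c - a.
have uw : dot u u <= dot u w by rewrite {2}/u /w !dotDr !dotNr lerD2r.
rewrite leNgt; apply/negP => u0.
have w1 : 0 < dot w w + 1 by rewrite ltr_wpDl// dot_ge0.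
(* moving from [a] towards [c] by [t] changes the squared distance by
   [t ^ 2 |w| ^ 2 - 2 t <u, w>], negative for this small [t] *)
pose t := Num.min 1 (dot u u / (dot w w + 1)).
have t0 : 0 < t by rewrite lt_min ltr01 divr_gt0.
have t1 : t <= 1 by rewrite ge_min lexx.
have tu : t * (dot w w + 1) <= dot u u by rewrite -ler_pdivlMr// ge_min lexx orbT.
have := amin _ (combination_reduce (combination_step (ltW t0) t1 aC Cc)).
have -> : a - v = (-1) *: u by rewrite scaleN1r opprB.
have -> : t *: c + (1 - t) *: a - v = (-1) *: u + t *: w.
  by apply/colP => i; rewrite !mxE; ring.
rewrite !(dotDl, dotDr) !(dotZl, dotZr) (dotC w u).
move: (dot u u) (dot w w) (dot u w) => U W D in uw u0 w1 tu *.
nra.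
Qed.

End support.

(** * Limits of gradients and Hessians *)

Section limits.
Context {R : realType}.

Lemma lipschitz_constant (U W : normedModType R) (f : U -> W) : lipschitz f ->
  exists2 L, 0 < L & lipschitz_with L f.
Proof.
move=> [M [Mr H]]; exists (`|M| + 1); first by rewrite ltr_wpDl.
have Ml : M < `|M| + 1 by rewrite (le_lt_trans (ler_norm M))// ltrDl.
by move=> x y; have := H _ Ml (x, y); apply.
Qed.

(** The limits of [F] along sequences in [P] tending to [x], stated without
    sequences: this makes the closedness immediate and spares extracting
    subsequences. *)
Definition limit_values (U W : normedModType R) (P : set U) (F : U -> W) (x : U) : set W :=
  [set v | forall e : R, 0 < e -> exists z, [/\ P z, `|z - x| < e & `|F z - v| < e]].

Lemma limit_valuesP (U W : normedModType R) (P : set U) (F : U -> W) x v :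
  (exists y : nat -> U, [/\ forall j, P (y j), y j @[j --> \oo] --> x &
     F (y j) @[j --> \oo] --> v]) <-> limit_values P F x v.
Proof.
split=> [[y [Py yx Fv]] e e0|H].
  near \oo => j; exists (y j); split => //.
    by near: j; move: yx => /cvgrPdist_lt/(_ _ e0); apply: filterS => j; rewrite distrC.
  by near: j; move: Fv => /cvgrPdist_lt/(_ _ e0); apply: filterS => j; rewrite distrC.
have /choice[y yP] : forall j : nat, exists z,
  [/\ P z, `|z - x| < j.+1%:R^-1 & `|F z - v| < j.+1%:R^-1].
  by move=> j; apply: H.
exists y; split => [j||]; first by case: (yP j).
  apply/cvgrPdist_lt => e e0; near=> j.
  rewrite distrC; case: (yP j) => _ /lt_trans + _; apply.
  by near: j; exact: near_infty_natSinv_lt (PosNum e0).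
apply/cvgrPdist_lt => e e0; near=> j.
rewrite distrC; case: (yP j) => _ _ /lt_trans; apply.
by near: j; exact: near_infty_natSinv_lt (PosNum e0).
Unshelve. all: by end_near. Qed.

Lemma closed_limit_values (U W : normedModType R) (P : set U) (F : U -> W) x :
  closed (limit_values P F x).
Proof.
move=> v cv e e0.
have e2 : 0 < e / 2 by rewrite divr_gt0.
have [v' [v'L]] := cv _ (nbhsx_ballx v _ e2); rewrite -ball_normE /= => vv'.
have [z [Pz zx zv']] := v'L _ e2; exists z; split => //.
  by rewrite (lt_trans zx)// ltr_pdivrMr// ltr_pMr// ltr1n.
rewrite (le_lt_trans (ler_distD v' _ _))// (splitr e) ltrD// distrC//.
Qed.

Lemma lip_diff (U W : normedModType R) (F : U -> W) L z v : lipschitz_with L F ->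
  differentiable F z -> `|'d F z v| <= L * `|v|.
Proof.
move=> LF dF; have [->|v0] := eqVneq v 0.
  by rewrite linear0 !normr0 mulr0.
have nv0 : 0 < `|v| by rewrite normr_gt0.
apply/ler_addgt0Pr => e e0.
have [d d0 dU] := diff_approx dF (divr_gt0 e0 nv0).
pose t := d / 2 / `|v|; have t0 : 0 < t by rewrite !divr_gt0.
have tv : `|t *: v| < d.
  by rewrite normrZ gtr0_norm// divfK ?gt_eqF// ltr_pdivrMr// ltr_pMr// ltr1n.
have := dU _ tv.
have -> : 'd F z (t *: v) = t *: 'd F z v by rewrite linearZ.
have := LF (z + t *: v) z; rewrite addrAC subrr add0r.
set D := F _ - F _ => HL Hd.
have : `|t *: 'd F z v| <= `|D| + `|D - t *: 'd F z v|.
  by rewrite -{1}[t *: _](subKr D) (le_trans (ler_normB _ _)).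
rewrite [X in X <= _]normrZ gtr0_norm// => H.
rewrite -(ler_pM2l t0) (le_trans H)// (le_trans (lerD HL Hd))//.
rewrite normrZ gtr0_norm// le_eqVlt; apply/orP; left; apply/eqP.
by rewrite mulrDr; congr (_ + _); [ring|rewrite mulrCA divfK ?gt_eqF].
Qed.

Lemma mx_box_compact m n (c : R) :
  compact [set M : 'M[R]_(m, n) | forall i j, `|M i j| <= c].
Proof.
have cK := @rV_compact R (m * n) (fun=> `[- c, c]%classic) (fun=> @segment_compact R (- c) c).
have cv : continuous (vec_mx : 'rV[R]_(m * n) -> 'M[R]_(m, n)).
  apply: (@lip_continuous _ _ _ 1) => u v; rewrite mul1r -linearB.
  by apply: norm_le_coord => // i j; rewrite mxE coord_le_norm.
rewrite (_ : mkset _ = vec_mx @` [set v : 'rV[R]_(m * n) | forall i, `[- c, c]%classic (v ord0 i)]).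
  by apply: continuous_compact => //; exact: continuous_subspaceT.
apply/seteqP; split => [M Mc|_ [v vc <-] i j]; last first.
  by rewrite mxE ler_norml; have := vc (mxvec_index i j); rewrite /= in_itv.
exists (mxvec M); last exact: mxvecK.
move=> k /=; case/mxvec_indexP: k => i j; rewrite mxvecE in_itv/= -ler_norml; exact: Mc.
Qed.

Lemma lip_mulmx m n (w : 'cV[R]_n) :
  lipschitz_with (\sum_(j < n) `|w j ord0|) (fun A : 'M[R]_(m, n) => A *m w).
Proof.
move=> A B; rewrite -mulmxBl.
apply: norm_le_coord => [|i j]; first by rewrite mulr_ge0// sumr_ge0.
rewrite mxE mulr_suml (le_trans (ler_norm_sum _ _ _))// ler_sum// => k _.
by rewrite normrM mulrC ord1 ler_wpM2l// coord_le_norm.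
Qed.

End limits.

Section clarke.
Context {R : realType} {n : nat}.
Notation V := 'cV[R]_n.
Variables (f : V -> R) (L : R) (w : V).
Hypotheses (df : forall x, differentiable f x) (L0 : 0 < L)
  (LG : lipschitz_with L (gradient f)).
Let g y := dot w (gradient f y).

Let hessian_limits (x : V) : set 'M[R]_n :=
  limit_values [set z | differentiable (gradient f) z] (hessian f) x.

Let gradient_limits (x : V) : set V :=
  limit_values [set z | differentiable g z] (gradient g) x.

(** Differentiating gives the transpose of the Hessian applied to [w], which the
    symmetry turns into the Hessian applied to [w]. *)
Lemma gradient_dot z : differentiable (gradient f) z ->
  differentiable g z /\ gradient g z = hessian f z *m w.
Proof.
move=> dG; have [dg dgE] := diff_dot w dG; split => //.
apply/colP => i; rewrite mxE.
have -> : 'd g z (delta_mx i ord0) = dot w ('d (gradient f) z (ebase i)).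
  by rewrite -[RHS](congr1 (@^~ (ebase i)) dgE).
by rewrite -hessian_mul hessian_sym// dot_ebase.
Qed.

Lemma hessian_le z i j : differentiable (gradient f) z -> `|hessian f z i j| <= L.
Proof.
move=> dG; rewrite mxE (le_trans (coord_le_norm _ _ _))//.
rewrite (le_trans (lip_diff (delta_mx j ord0) LG dG))//.
by rewrite ger_pMr// (norm_ebase j).
Qed.

Lemma compact_hessian_limits x : compact (hessian_limits x).
Proof.
apply: (subclosed_compact _ (@mx_box_compact R n n (L + 1))).
  exact: closed_limit_values.
move=> A HA i j; have [z [dG _ zA]] := HA 1 ltr01.
have h2 := hessian_le i j dG; have := le_trans (coord_le_norm _ i j) (ltW zA).
rewrite [(_ - A) i j]mxE [(- A) i j]mxE => h1.
rewrite -[A i j](subKr (hessian f z i j)) (le_trans (ler_normB _ _))//.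
by rewrite lerD.
Qed.

Lemma hessian_limits_sub x A : hessian_limits x A -> gradient_limits x (A *m w).
Proof.
move=> HA e e0; pose C := \sum_(i < n) `|w i ord0| + 1.
have C0 : 0 < C by rewrite ltr_wpDl// sumr_ge0.
(* [C] is a Lipschitz constant of [B |-> B *m w] *)
pose e' := Num.min e (e / C).
have e'0 : 0 < e' by rewrite lt_min e0 divr_gt0.
have [z [dG zx zA]] := HA _ e'0.
have [dg gE] := gradient_dot dG.
exists z; split => //; first by rewrite (lt_le_trans zx)// ge_min lexx.
rewrite gE (le_lt_trans (lip_mulmx _ _ _))//.
apply: (@le_lt_trans _ _ (C * `|hessian f z - A|)).
  by rewrite ler_wpM2r// /C lerDl.
by rewrite -ltr_pdivlMl// mulrC (lt_le_trans zA)// ge_min lexx orbT.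
Qed.

(** The expansion of [g] at a point whose gradient is close to [v] yields a segment
    to which the mean value inequality applies. *)
Lemma gradient_limit_approx x u v e : gradient_limits x v -> 0 < e ->
  exists z, [/\ differentiable (gradient f) z, `|z - x| < e &
    dot u v - e * (\sum_(i < n) `|u i ord0| + `|u| + 1) < dot u (hessian f z *m w)].
Proof.
move=> vx e0; have e2 : 0 < e / 2 by rewrite divr_gt0.
have arith (p q S N : R) : p - q <= S * (e / 2) -> 0 <= e * S ->
    p - e * (S + N + 1) < q - e * N - e / 2 by lra.
have [z0 [dg z0x z0v]] := vx _ e2.
have [d d0 dU] := diff_approx dg e0.
pose t := Num.min d (e / 2) / (2 * (`|u| + 1)).
have u1 : 0 < `|u| + 1 by rewrite ltr_wpDl.
have m0 : 0 < Num.min d (e / 2) by rewrite lt_min d0.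
have t0 : 0 < t by rewrite divr_gt0// mulr_gt0.
have tu : `|t *: u| < Num.min d (e / 2).
  rewrite normrZ gtr0_norm// /t mulrAC ltr_pdivrMr ?mulr_gt0//.
  by rewrite ltr_pM2l//; lra.
have [tud tue] : `|t *: u| < d /\ `|t *: u| < e / 2.
  by move: tu; rewrite lt_min => /andP[].
have gt := dU _ tud.
pose c := dot u (gradient g z0) - e * `|u| - e / 2.
have ct : c * t < g (z0 + t *: u) - g z0.
  have dgt : 'd g z0 (t *: u) = t * dot u (gradient g z0).
    by rewrite (diff_gradient g z0 (t *: u)) dotZr dotC.
  move: gt; rewrite dgt normrZ gtr0_norm//.
  rewrite /c; move: (g (z0 + t *: u) - g z0) (dot u _) => D p.
  rewrite ler_norml => /andP[+ _] => h.
  have te : 0 < t * (e / 2) by rewrite mulr_gt0.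
  by move: `|u| h te => N; lra.
have [z [zz0 dG cz]] := mean_value_diff LG t0 tue ct.
exists z; split => //.
  by rewrite (le_lt_trans (ler_distD z0 _ _))// (splitr e) ltrD.
rewrite hessian_sym//.
rewrite -hessian_mul in cz.
apply: lt_le_trans cz; rewrite /c.
have h : dot u v - dot u (gradient g z0) <= (\sum_(i < n) `|u i ord0|) * (e / 2).
  rewrite -dotNr -dotDr (le_trans (ler_norm _))// (le_trans (dot_le _ _))//.
  by rewrite ler_wpM2l ?sumr_ge0// distrC ltW.
by apply: arith => //; rewrite mulr_ge0 ?sumr_ge0// ltW.
Qed.

(** [A] is a cluster point of the Hessians found by [gradient_limit_approx]. *)
Lemma gradient_limits_support x u v : gradient_limits x v ->
  exists2 A, hessian_limits x A & dot u v <= dot u (A *m w).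
Proof.
move=> vx; pose K := \sum_(i < n) `|u i ord0| + `|u| + 1.
have K0 : 0 < K by rewrite ltr_wpDl// addr_ge0// sumr_ge0.
have /choice[z zP] : forall k : nat, exists z, [/\ differentiable (gradient f) z,
    `|z - x| < k.+1%:R^-1 & dot u v - k.+1%:R^-1 * K < dot u (hessian f z *m w)].
  by move=> k; exact: gradient_limit_approx.
have [A [_ clA]] : [set M : 'M[R]_n | forall i j, `|M i j| <= L] `&`
    cluster (hessian f (z k) @[k --> \oo]) !=set0.
  apply: mx_box_compact; exists 0%N => // k _ i j.
  by apply: hessian_le; case: (zP k).
have clE e : 0 < e -> exists k : nat, k.+1%:R^-1 < e /\ `|hessian f (z k) - A| < e.
  move=> e0.
  have : (hessian f (z k) @[k --> \oo]) [set B | exists k : nat, k.+1%:R^-1 < e /\ B = hessian f (z k)].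
    have := near_infty_natSinv_lt (PosNum e0); apply: filterS => k ke.
    by exists k.
  move=> /clA/(_ (nbhsx_ballx A _ e0))[B [[k [ke ->]]]].
  by rewrite -ball_normE /= => Ak; exists k; split => //; rewrite distrC.
exists A.
  move=> e e0; have [k [ke kA]] := clE e e0; exists (z k).
  by case: (zP k) => dG zx _; split => //; exact: lt_trans zx ke.
apply/ler_addgt0Pr => eta eta0.
have arith (a b c r q s C D : R) : 0 < q -> a - r < c -> c - b <= s -> s <= C * (D * q) ->
    r <= q * K -> q * (K + C * D + 1) = eta -> a <= b + eta by nra.
pose Cw := \sum_(i < n) `|w i ord0|; pose Cu := \sum_(i < n) `|u i ord0|.
have Cw0 : 0 <= Cw by rewrite sumr_ge0.
have Cu0 : 0 <= Cu by rewrite sumr_ge0.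
have D0 : 0 < K + Cu * Cw + 1 by rewrite ltr_wpDl// addr_ge0 ?mulr_ge0// ltW.
have [k [ke kA]] := clE _ (divr_gt0 eta0 D0).
have [_ _ zv] := zP k.
have h1 : dot u (hessian f (z k) *m w) - dot u (A *m w) <= Cu * (Cw * `|hessian f (z k) - A|).
  rewrite -dotNr -dotDr (le_trans (ler_norm _))// (le_trans (dot_le _ _))//.
  by rewrite ler_wpM2l//; exact: lip_mulmx.
set q := eta / _ in ke kA.
have h2 : Cu * (Cw * `|hessian f (z k) - A|) <= Cu * (Cw * q).
  by rewrite !ler_wpM2l// ltW.
have h3 : k.+1%:R^-1 * K <= q * K by rewrite ler_wpM2r ?ltW.
have h4 : q * (K + Cu * Cw + 1) = eta by rewrite divfK// gt_eqF.
have q0 : 0 < q by rewrite divr_gt0.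
exact: arith q0 zv h1 h2 h3 h4.
Qed.

(** The map [B |-> B *m w] carries convex hulls to convex hulls, so it is enough to
    place the generators of each side in the other one. *)
Lemma clarke_hessian_appE x : clarke_hessian_app f x w = clarke_subdiff g x.
Proof.
have HE : clarke_hessian f x = conv_hull (hessian_limits x).
  congr conv_hull; apply/seteqP; split => A.
    move=> [y [yd yx yA]]; apply/limit_valuesP; exists y; split => // j.
    by case: (yd j).
  move=> /limit_valuesP[y [yd yx yA]]; exists y; split => // j.
  by split; [apply: filterE => z; exact: df|exact: yd].
have GE : clarke_subdiff g x = conv_hull (gradient_limits x).
  have H := limit_valuesP [set z | differentiable g z] (gradient g) x.
  by congr conv_hull; apply/seteqP; split => v /H.
rewrite /clarke_hessian_app HE GE; apply/seteqP; split.
  move=> _ [A HA <-].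
  have : [set B : 'M[R]_n | conv_hull (gradient_limits x) (B *m w)] A; last by [].
  apply: conv_hull_min HA; last by move=> B /hessian_limits_sub; exact: sub_conv_hull.
  apply: convex_set_intro => t B B' t0 t1 /= HB HB'.
  by rewrite mulmxDl -!scalemxAl; apply: (convex_set_combine (@convex_conv_hull _ _ _)).
have cI : convex_set ([set A *m w | A in conv_hull (hessian_limits x)] : set V).
  apply: convex_set_intro => t _ _ t0 t1 [B HB <-] [B' HB' <-].
  exists (t *: B + (1 - t) *: B'); last by rewrite mulmxDl -!scalemxAl.
  exact: (convex_set_combine (@convex_conv_hull _ _ _)).
apply: conv_hull_min => // v vx.
have : conv_hull [set A *m w | A in hessian_limits x] v.
  apply: mem_conv_hull_of_support.
    apply: continuous_compact; last exact: compact_hessian_limits.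
    apply: continuous_subspaceT; exact: lip_continuous (lip_mulmx w).
  by move=> u; have [A HA uA] := gradient_limits_support u vx; exists (A *m w) => //; exists A.
by apply: conv_hull_min => // _ [A HA <-]; exists A => //; exact: sub_conv_hull.
Qed.

End clarke.

Theorem corollary2p7 (R : realType) (n : nat) (delta : R) (f : 'cV[R]_n -> R)
    (hdelta : 0 <= delta) (hf : C11 f) (x w : 'cV[R]_n) :
  goldstein_hessian delta f x w =
  goldstein_subdiff delta (fun y => dot w (gradient f y)) x.
Proof.
have [df /lipschitz_constant[L L0 LG]] := hf.
congr conv_hull; apply: eq_bigcupr => y _.
exact: clarke_hessian_appE df L0 LG y.
Qed.
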